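(* Let $K\subseteq\mathbb{R}^d$ be a convex body, and let $\mathcal F=\{\lambda_1K,\lambda_2K,\dots\}$ with all $\lambda_i>0$ be a family of its homothets such that the set $\{\lambda_1,\lambda_2,\dots\}$ is unbounded. Then $\mathcal F$ permits a translative covering of $\mathbb{R}^d$ in which every point is covered at most $4d$ times. Moreover, if $K$ is smooth at every point where $K$ meets a supporting hyperplane of $K$ that is parallel to one of the $d$ coordinate hyperplanes, then $\mathcal F$ permits a translative covering of $\mathbb{R}^d$ in which every point is covered at most $2d$ times.
   Context: A convex body is a compact convex subset of $\mathbb{R}^d$ with nonempty interior. $\mathcal F$ permits a translative covering of $A$ if one can select a translation vector $x_F$ for each member $F\in\mathcal F$ such that $A\subseteq\bigcup_{F\in\mathcal F}(x_F+F)$. $K$ is smooth at a boundary point if it has a unique supporting hyperplane there. *)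

(* Defs.v *)
From Stdlib Require Import Reals List.
From Stdlib Require Fin.
Open Scope R_scope.

Definition point (d : nat) := Fin.t d -> R.

Fixpoint dot (d : nat) : point d -> point d -> R :=
  match d return point d -> point d -> R with
  | 0 => fun _ _ => 0
  | S n => fun u v => u Fin.F1 * v Fin.F1
                      + dot n (fun i => u (Fin.FS i)) (fun i => v (Fin.FS i))
  end.

(* Convexity, compactness (closed + bounded), nonempty interior.
   Topology via the sup-norm (equivalent to the Euclidean one). *)
Definition convex {d} (K : point d -> Prop) : Prop :=
  forall x y t, K x -> K y -> 0 <= t <= 1 ->
    K (fun i => (1 - t) * x i + t * y i).

Definition closed_set {d} (K : point d -> Prop) : Prop :=
  forall x, (forall eps, 0 < eps -> exists y, K y /\ forall i, Rabs (x i - y i) < eps) -> K x.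

Definition bounded_set {d} (K : point d -> Prop) : Prop :=
  exists M, forall x, K x -> forall i, Rabs (x i) <= M.

Definition nonempty_interior {d} (K : point d -> Prop) : Prop :=
  exists x r, 0 < r /\ forall y, (forall i, Rabs (y i - x i) < r) -> K y.

Definition convex_body {d} (K : point d -> Prop) : Prop :=
  convex K /\ closed_set K /\ bounded_set K /\ nonempty_interior K.

Definition translated_homothet {d} (K : point d -> Prop) (lam : R) (x : point d)
  : point d -> Prop :=
  fun p => exists k, K k /\ forall i, p i = x i + lam * k i.

(* Translative covering of R^d by the family (lam_n K)_n, each point covered
   at most m times (counting members of the family with multiplicity). *)
Definition translative_covering_mult {d} (K : point d -> Prop) (lam : nat -> R)
  (m : nat) : Prop :=
  exists x : nat -> point d,
    (forall p : point d, exists n, translated_homothet K (lam n) (x n) p) /\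
    (forall (p : point d) (l : list nat), NoDup l ->
        (forall n, In n l -> translated_homothet K (lam n) (x n) p) ->
        (length l <= m)%nat).

Definition supporting_hyperplane {d} (K : point d -> Prop) (H : point d -> Prop)
  (b : point d) : Prop :=
  K b /\ H b /\
  exists (u : point d) (c : R), u <> (fun _ => 0) /\
    (forall y, H y <-> dot d u y = c) /\
    (forall y, K y -> dot d u y <= c).

Definition smooth_at {d} (K : point d -> Prop) (b : point d) : Prop :=
  forall H1 H2, supporting_hyperplane K H1 b -> supporting_hyperplane K H2 b ->
    forall y, H1 y <-> H2 y.

Definition smooth_at_coordinate_support_points {d} (K : point d -> Prop) : Prop :=
  forall (j : Fin.t d) (c : R) (b : point d),
    supporting_hyperplane K (fun y => y j = c) b -> smooth_at K b.

(* Main.v *)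
Require Import Defs.
From Stdlib Require Import Reals List Lra Lia Psatz.
From Stdlib Require Import Classical ClassicalEpsilon FunctionalExtensionality.
From Stdlib Require Fin FinFun.
Import ListNotations.
Open Scope R_scope.

(** If the boundary of [K] is flat enough near a point with inner normal [n] (because
    a ball inside [K] touches it there, or because [K] is smooth there), then a large
    homothet of [K] looks inside any given bounded region like a half-space [{n.p >= r}].
    Let [U] be finitely many such normals that positively span the space, and let
    [g p] be the maximum of [u.p] over [u] in [U].  Starting from a single body that
    covers [{g <= 2}], pass from a finite family covering [{g <= r}] to one covering
    [{g <= r']}, with [r'] beyond everything placed so far, by adding [#U] huge bodies
    that lie in [{u.p >= r - 1}] and look like [{u.p >= r}].  Only two consecutive rounds
    meet at a point, and there is a region met by one round only, in which the next
    unused member of the family can be placed.  If no point lies in more than [h] of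
    the half-spaces [{u.p > 0}], the multiplicity is at most [2h].

    Normals at touching points of inscribed balls positively span, and [2d] of them
    suffice (a basis and, by Caratheodory, [d] more), so [h = 2d].  In the smooth case
    [U] consists of the coordinate vectors and their opposites, so [h = d]. *)

(** * Vectors *)

Definition vzero {d} : point d := fun _ => 0.
Definition vadd {d} (x y : point d) : point d := fun i => x i + y i.
Definition vscal {d} (c : R) (x : point d) : point d := fun i => c * x i.
Definition vsub {d} (x y : point d) : point d := fun i => x i - y i.
Definition ebas {d} (j : Fin.t d) : point d :=
  fun i => if Fin.eq_dec j i then 1 else 0.
Definition norm1 {d} (x : point d) : R := dot d (fun i => Rabs (x i)) (fun _ => 1).

Definition vcons {n} (a : R) (x : point n) : point (S n) :=
  fun i => Fin.caseS' i (fun _ => R) a x.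

Ltac vext := let i := fresh "i" in
  apply functional_extensionality; intro i; unfold vzero, vadd, vscal, vsub.

Lemma vcons_eta {n} (x : point (S n)) :
  x = vcons (x Fin.F1) (fun i => x (Fin.FS i)).
Proof.
  apply functional_extensionality; intro i; unfold vcons.
  now apply (Fin.caseS' i).
Qed.

Lemma fin_S_forall n (P : Fin.t (S n) -> Prop) :
  P Fin.F1 -> (forall i, P (Fin.FS i)) -> forall i, P i.
Proof. intros H1 H2 i; now apply (Fin.caseS' i). Qed.

Lemma dot_comm d (u v : point d) : dot d u v = dot d v u.
Proof.
  induction d as [|d IH]; simpl; [reflexivity|].
  rewrite IH; ring.
Qed.

Lemma dot_vadd_r d (u x y : point d) : dot d u (vadd x y) = dot d u x + dot d u y.
Proof.
  induction d as [|d IH]; simpl; [ring|].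
  unfold vadd in *; rewrite (IH (fun i => u (Fin.FS i)) (fun i => x (Fin.FS i))); ring.
Qed.

Lemma dot_vscal_r d c (u x : point d) : dot d u (vscal c x) = c * dot d u x.
Proof.
  induction d as [|d IH]; simpl; [ring|].
  unfold vscal in *; rewrite (IH (fun i => u (Fin.FS i)) (fun i => x (Fin.FS i))); ring.
Qed.

Lemma vsub_vadd d (x y : point d) : vsub x y = vadd x (vscal (-1) y).
Proof. vext; ring. Qed.

Lemma dot_vsub_r d (u x y : point d) : dot d u (vsub x y) = dot d u x - dot d u y.
Proof. rewrite vsub_vadd, dot_vadd_r, dot_vscal_r; ring. Qed.

Lemma dot_vadd_l d (u x y : point d) : dot d (vadd x y) u = dot d x u + dot d y u.
Proof. rewrite !(dot_comm d _ u); apply dot_vadd_r. Qed.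

Lemma dot_vscal_l d c (u x : point d) : dot d (vscal c x) u = c * dot d x u.
Proof. rewrite !(dot_comm d _ u); apply dot_vscal_r. Qed.

Lemma dot_vsub_l d (u x y : point d) : dot d (vsub x y) u = dot d x u - dot d y u.
Proof. rewrite !(dot_comm d _ u); apply dot_vsub_r. Qed.

Lemma dot_vzero_r d (u : point d) : dot d u vzero = 0.
Proof.
  replace (@vzero d) with (vscal 0 (@vzero d)) by (vext; ring).
  rewrite dot_vscal_r; ring.
Qed.

Lemma dot_vzero_l d (u : point d) : dot d vzero u = 0.
Proof. rewrite dot_comm; apply dot_vzero_r. Qed.

Ltac dots := rewrite ?dot_vadd_l, ?dot_vadd_r, ?dot_vsub_l, ?dot_vsub_r,
  ?dot_vscal_l, ?dot_vscal_r, ?dot_vzero_l, ?dot_vzero_r;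
  repeat (progress rewrite ?dot_vadd_l, ?dot_vadd_r, ?dot_vsub_l, ?dot_vsub_r,
  ?dot_vscal_l, ?dot_vscal_r, ?dot_vzero_l, ?dot_vzero_r).

Lemma dot_self_comb d c (x y : point d) :
  dot d (vadd x (vscal c y)) (vadd x (vscal c y)) =
  dot d x x + 2 * c * dot d x y + c * c * dot d y y.
Proof. dots; rewrite (dot_comm d y x); ring. Qed.

Lemma dot_ebas d (u : point d) j : dot d u (ebas j) = u j.
Proof.
  induction j as [n|n j IH]; simpl.
  - unfold ebas at 1.
    destruct (Fin.eq_dec Fin.F1 Fin.F1) as [_|E]; [|now contradiction E].
    replace (fun i : Fin.t n => ebas Fin.F1 (Fin.FS i)) with (@vzero n).
    + rewrite dot_vzero_r; ring.
    + vext; unfold ebas.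
      destruct (Fin.eq_dec Fin.F1 (Fin.FS i)) as [E|_]; [discriminate E|reflexivity].
  - unfold ebas at 1.
    destruct (Fin.eq_dec (Fin.FS j) Fin.F1) as [E|_]; [discriminate E|].
    replace (fun i : Fin.t n => ebas (Fin.FS j) (Fin.FS i)) with (ebas j).
    + rewrite IH; ring.
    + apply functional_extensionality; intro i; unfold ebas.
      destruct (Fin.eq_dec j i) as [E|E], (Fin.eq_dec (Fin.FS j) (Fin.FS i)) as [E'|E'];
        try reflexivity.
      * now contradiction E'; f_equal.
      * now contradiction E; apply Fin.FS_inj.
Qed.

Lemma dot_self_nonneg d (x : point d) : 0 <= dot d x x.
Proof.
  induction d as [|d IH]; simpl; [lra|].
  specialize (IH (fun i => x (Fin.FS i))); nra.
Qed.

Lemma coord_sqr_le_dot d (x : point d) i : x i * x i <= dot d x x.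
Proof.
  induction i as [n|n i IH]; simpl.
  - pose proof (dot_self_nonneg n (fun i => x (Fin.FS i))); lra.
  - specialize (IH (fun i => x (Fin.FS i))); simpl in IH; nra.
Qed.

Lemma dot_self_zero d (x : point d) : dot d x x <= 0 -> x = vzero.
Proof.
  intros H; vext; pose proof (coord_sqr_le_dot d x i); nra.
Qed.

Lemma norm1_nonneg d (x : point d) : 0 <= norm1 x.
Proof.
  unfold norm1; induction d as [|d IH]; simpl; [lra|].
  specialize (IH (fun i => x (Fin.FS i))); simpl in IH.
  pose proof (Rabs_pos (x Fin.F1)); lra.
Qed.

Lemma dot_bound d (u h : point d) M :
  (forall i, Rabs (h i) <= M) -> Rabs (dot d u h) <= norm1 u * M.
Proof.
  unfold norm1; revert u h; induction d as [|d IH]; simpl; intros u h H.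
  - rewrite Rabs_R0; lra.
  - specialize (IH (fun i => u (Fin.FS i)) (fun i => h (Fin.FS i)) (fun i => H (Fin.FS i))).
    eapply Rle_trans; [apply Rabs_triang|]; rewrite Rabs_mult.
    pose proof (H Fin.F1); pose proof (Rabs_pos (u Fin.F1)); nra.
Qed.

Lemma norm1_bound d (x : point d) M :
  (forall i, Rabs (x i) <= M) -> norm1 x <= INR d * M.
Proof.
  unfold norm1; induction d as [|d IH]; intros H; [simpl; lra|].
  specialize (IH (fun i => x (Fin.FS i)) (fun i => H (Fin.FS i))).
  rewrite S_INR; simpl; specialize (H Fin.F1); lra.
Qed.

Lemma dot_self_bound d (x : point d) M :
  (forall i, Rabs (x i) <= M) -> 0 <= M -> dot d x x <= INR d * M * M.
Proof.
  intros H HM; pose proof (dot_bound d x x M H); pose proof (norm1_bound d x M H).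
  pose proof (Rle_abs (dot d x x)); nra.
Qed.

Lemma fin_argmax n (f : Fin.t (S n) -> R) : exists i, forall j, f j <= f i.
Proof.
  induction n as [|n IH].
  - exists Fin.F1; apply fin_S_forall; [lra|]; intro i; inversion i.
  - destruct (IH (fun i => f (Fin.FS i))) as [i Hi].
    destruct (Rle_dec (f Fin.F1) (f (Fin.FS i))).
    + exists (Fin.FS i); now apply fin_S_forall.
    + exists Fin.F1; apply fin_S_forall; [lra|].
      intro j; specialize (Hi j); simpl in Hi; lra.
Qed.

Lemma coord_bound d (x : point d) : exists M, 0 <= M /\ forall i, Rabs (x i) <= M.
Proof.
  destruct d as [|d].
  - exists 0; split; [lra|]; intro i; inversion i.
  - destruct (fin_argmax d (fun i => Rabs (x i))) as [i Hi].
    exists (Rabs (x i)); split; [apply Rabs_pos|exact Hi].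
Qed.

Lemma max_coord d (x : point d) : x <> vzero ->
  exists i, 0 < Rabs (x i) /\ forall j, Rabs (x j) <= Rabs (x i).
Proof.
  intros Hx; destruct d as [|m]; [contradiction Hx; vext; inversion i|].
  destruct (fin_argmax m (fun i => Rabs (x i))) as [i Hi]; exists i; split; [|exact Hi].
  apply Rnot_le_lt; intros Hle; apply Hx; vext; specialize (Hi i0).
  destruct (Req_dec (x i0) 0) as [|Hne]; [assumption|].
  apply Rabs_pos_lt in Hne; lra.
Qed.

(** * Finite lists of coordinates and of functions on them *)

Fixpoint fins (d : nat) : list (Fin.t d) :=
  match d with
  | 0 => []
  | S n => Fin.F1 :: map Fin.FS (fins n)
  end.

Lemma in_fins d (i : Fin.t d) : In i (fins d).
Proof. induction i; simpl; [now left|right; now apply in_map]. Qed.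

Lemma length_fins d : length (fins d) = d.
Proof. induction d; simpl; [reflexivity|]; now rewrite length_map, IHd. Qed.

Lemma NoDup_fins d : NoDup (fins d).
Proof.
  induction d as [|d IH]; simpl; constructor.
  - intros H; apply in_map_iff in H as [x [E _]]; discriminate E.
  - apply FinFun.Injective_map_NoDup; [|exact IH].
    intros x y; apply Fin.FS_inj.
Qed.

(** Serves twice: a finite net of real values becomes a finite net of a cube, and the two booleans
    become the list of vertices of a box. *)
Fixpoint all_funs {A} (d : nat) (l : list A) : list (Fin.t d -> A) :=
  match d with
  | 0 => [fun i => Fin.case0 (fun _ => A) i]
  | S n => flat_map (fun a => map (fun f i => Fin.caseS' i (fun _ => A) a f)
                                  (all_funs n l)) l
  end.

Lemma in_all_funs {A} d (l : list A) (f : Fin.t d -> A) :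
  (forall i, In (f i) l) -> In f (all_funs d l).
Proof.
  induction d as [|d IH]; simpl; intros H.
  - left; apply functional_extensionality; intro i; inversion i.
  - apply in_flat_map; exists (f Fin.F1); split; [apply H|].
    apply in_map_iff; exists (fun i => f (Fin.FS i)); split.
    + apply functional_extensionality; intro i; now apply (Fin.caseS' i).
    + apply IH; intro i; apply H.
Qed.

(** * Compactness *)

(** The cluster point is an upper limit: the supremum [l] of all [t] such that every [A k] has a
    point at or above [t]. Some stage has no point at or above [l + eps / 2], while every stage has
    points above [l - eps]. *)
Lemma nested_cluster_R (A : nat -> R -> Prop) M :
  (forall k, exists x, A k x) -> (forall k x, A (S k) x -> A k x) ->
  (forall k x, A k x -> Rabs x <= M) ->
  exists l, forall k eps, 0 < eps -> exists x, A k x /\ Rabs (x - l) < eps.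
Proof.
  intros Hne Hnest Hbd.
  assert (Hmono : forall k n x, A (n + k)%nat x -> A k x).
  { intros k n; induction n as [|n IH]; intros x H; [exact H|].
    apply IH, Hnest, H. }
  destruct (completeness (fun t => forall k, exists x, A k x /\ t <= x)) as [l [Hub Hlub]].
  - exists M; intros t Ht; destruct (Ht 0%nat) as [x [Hx Htx]].
    pose proof (Hbd _ _ Hx); pose proof (Rle_abs x); lra.
  - exists (-M); intros k; destruct (Hne k) as [x Hx]; exists x; split; [exact Hx|].
    pose proof (Hbd _ _ Hx); pose proof (Rle_abs (- x)); rewrite Rabs_Ropp in *; lra.
  - exists l; intros k eps Heps.
    assert (H1 : ~ forall k, exists x, A k x /\ l + eps / 2 <= x).
    { intros H; specialize (Hub _ H); lra. }
    apply not_all_ex_not in H1 as [k0 Hk0].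
    destruct (classic (exists t, (forall k, exists x, A k x /\ t <= x) /\ l - eps < t))
      as [[t [Ht Hlt]]|Hn].
    + destruct (Ht (k + k0)%nat) as [x [Hx Htx]].
      exists x; split.
      * apply (Hmono k k0); now rewrite Nat.add_comm.
      * apply Rabs_def1; [|lra].
        apply Rnot_le_lt; intros Hle; apply Hk0; exists x; split; [|lra].
        now apply (Hmono k0 k).
    + exfalso; assert (l <= l - eps); [|lra].
      apply Hlub; intros t Ht; apply Rnot_lt_le; intros Hlt; apply Hn; now exists t.
Qed.

Lemma inv_INR_lt eps : 0 < eps -> exists k, / INR (S k) < eps.
Proof.
  intros H; destruct (archimed_cor1 eps H) as [n [Hn Hn0]].
  exists (pred n); now replace (S (pred n)) with n by lia.
Qed.

Lemma inv_INR_S_pos k : 0 < / INR (S k).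
Proof. apply Rinv_0_lt_compat, lt_0_INR; lia. Qed.

Lemma inv_INR_mono k n : (k <= n)%nat -> / INR (S n) <= / INR (S k).
Proof.
  intros H; apply Rinv_le_contravar; [apply lt_0_INR; lia|apply le_INR; lia].
Qed.

(** Bolzano-Weierstrass for nested sets, by induction on the dimension. Once the first coordinates
    cluster at [l1], the points of [A k] with first coordinate within [/ INR (S k)] of [l1] still
    form nonempty nested sets, and their tails cluster by induction. *)
Lemma nested_cluster d (A : nat -> point d -> Prop) M :
  (forall k, exists x, A k x) -> (forall k x, A (S k) x -> A k x) ->
  (forall k x, A k x -> forall i, Rabs (x i) <= M) ->
  exists l : point d, forall k eps, 0 < eps ->
    exists x, A k x /\ forall i, Rabs (x i - l i) < eps.
Proof.
  revert A; induction d as [|d IH]; intros A Hne Hnest Hbd.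
  - exists vzero; intros k eps _; destruct (Hne k) as [x Hx]; exists x; split; [exact Hx|].
    intro i; inversion i.
  - assert (Hmono : forall k n x, A (n + k)%nat x -> A k x).
    { intros k n; induction n as [|n IHn]; intros x H; [exact H|].
      apply IHn, Hnest, H. }
    destruct (nested_cluster_R (fun k t => exists x, A k x /\ x Fin.F1 = t) M) as [l1 Hl1].
    { intros k; destruct (Hne k) as [x Hx]; now exists (x Fin.F1), x. }
    { intros k t [x [Hx E]]; exists x; split; [now apply Hnest|exact E]. }
    { intros k t [x [Hx E]]; subst t; now apply (Hbd k). }
    destruct (IH (fun k y => exists x, A k x /\ Rabs (x Fin.F1 - l1) < / INR (S k)
                                       /\ y = fun i => x (Fin.FS i))) as [l Hl].
    { intros k; destruct (Hl1 k _ (inv_INR_S_pos k)) as [t [[x [Hx E]] Ht]].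
      subst t; exists (fun i => x (Fin.FS i)), x; auto. }
    { intros k y [x [Hx [H1 H2]]]; exists x; split; [now apply Hnest|split; [|exact H2]].
      eapply Rlt_le_trans; [exact H1|apply inv_INR_mono; lia]. }
    { intros k y [x [Hx [_ ->]]] i; now apply (Hbd k). }
    exists (vcons l1 l); intros k eps Heps.
    destruct (inv_INR_lt eps Heps) as [k0 Hk0].
    (* The index [k + k0] is late enough both for membership in [A k] and for the first coordinate
       to be within [eps]. *)
    destruct (Hl (k + k0)%nat eps Heps) as [y [[x [Hx [H1 ->]]] Hy]].
    exists x; split.
    + apply (Hmono k k0); now rewrite Nat.add_comm.
    + apply fin_S_forall; [|exact Hy].
      simpl; pose proof (inv_INR_mono k0 (k + k0) ltac:(lia)); lra.
Qed.

(** * Linear inequalities *)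

Inductive span {d} (F : list (point d)) : point d -> Prop :=
| span_zero : span F vzero
| span_add c f v : In f F -> span F v -> span F (vadd (vscal c f) v).

(** An upper bound [n] on the dimension of the span of [U]; the spanning vectors need be neither
    independent nor members of [U]. *)
Definition spanned_by {d} (n : nat) (U : list (point d)) : Prop :=
  exists F, length F = n /\ forall u, In u U -> span F u.

(* The projection along [f] onto the functionals vanishing at [x0]. *)
Definition elim {d} (f x0 u : point d) : point d :=
  vsub u (vscal (dot d u x0 / dot d f x0) f).

Definition csum {d} (Z : list (R * point d)) : point d :=
  fold_right (fun cz acc => vadd (vscal (fst cz) (snd cz)) acc) vzero Z.

Lemma elim_add d (f x0 u : point d) c v :
  elim f x0 (vadd (vscal c u) v) = vadd (vscal c (elim f x0 u)) (elim f x0 v).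
Proof. unfold elim; dots; vext; unfold Rdiv; ring. Qed.

Lemma elim_zero d (f x0 : point d) : elim f x0 vzero = vzero.
Proof. unfold elim; dots; vext; unfold Rdiv; ring. Qed.

Lemma elim_self d (f x0 : point d) : dot d f x0 <> 0 -> elim f x0 f = vzero.
Proof. intros H; unfold elim; vext; field; exact H. Qed.

Lemma elim_kernel d (f x0 u : point d) : dot d u x0 = 0 -> elim f x0 u = u.
Proof. intros H; unfold elim; rewrite H; vext; unfold Rdiv; ring. Qed.

Lemma dot_elim_same d (f x0 u : point d) : dot d f x0 <> 0 -> dot d (elim f x0 u) x0 = 0.
Proof. intros H; unfold elim; dots; field; exact H. Qed.

Lemma span_comb {d} (F : list (point d)) c u v :
  span F u -> span F v -> span F (vadd (vscal c u) v).
Proof.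
  intros Hu Hv; induction Hu as [|c' f u Hf Hu IH].
  - replace (vadd (vscal c vzero) v) with v by (vext; ring); exact Hv.
  - replace (vadd (vscal c (vadd (vscal c' f) u)) v)
      with (vadd (vscal (c * c') f) (vadd (vscal c u) v)) by (vext; ring).
    now constructor.
Qed.

Lemma span_elim {d} (F1 F2 : list (point d)) f x0 v :
  dot d f x0 <> 0 -> span (F1 ++ f :: F2) v ->
  span (map (elim f x0) (F1 ++ F2)) (elim f x0 v).
Proof.
  intros Hf Hv; induction Hv as [|c g v Hg Hv IH].
  - rewrite elim_zero; constructor.
  - rewrite elim_add; apply in_app_iff in Hg as [Hg|[<-|Hg]].
    + constructor; [apply in_map, in_app_iff; now left|exact IH].
    + rewrite elim_self by exact Hf.
      replace (vadd (vscal c vzero) (elim f x0 v)) with (elim f x0 v) by (vext; ring).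
      exact IH.
    + constructor; [apply in_map, in_app_iff; now right|exact IH].
Qed.

Lemma span_nonvanishing {d} (F : list (point d)) x0 v :
  span F v -> dot d v x0 <> 0 -> exists f, In f F /\ dot d f x0 <> 0.
Proof.
  intros Hv; induction Hv as [|c f v Hf Hv IH]; intros H.
  - now rewrite dot_vzero_l in H.
  - rewrite dot_vadd_l, dot_vscal_l in H.
    destruct (Req_dec (dot d f x0) 0) as [E|E]; [|now exists f].
    apply IH; intros E'; apply H; rewrite E, E'; ring.
Qed.

(** Some spanning vector [f] does not vanish at [x0]. Projecting along [f] kills it, so the
    projections of the other vectors span everything that already vanishes at [x0], in particular
    the vectors [elim a x0 u]. *)
Lemma spanned_by_elim {d} n (U : list (point d)) a x0 :
  spanned_by n U -> In a U -> dot d a x0 <> 0 ->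
  exists n', n = S n' /\ spanned_by n' (map (elim a x0) U).
Proof.
  intros [F [HF HU]] Ha H0.
  destruct (span_nonvanishing F x0 a (HU a Ha) H0) as [f [Hf Hf0]].
  apply in_split in Hf as [F1 [F2 ->]].
  rewrite length_app in HF; simpl in HF.
  exists (length F1 + length F2)%nat; split; [lia|].
  exists (map (elim f x0) (F1 ++ F2)); split.
  - now rewrite length_map, length_app.
  - intros w Hw; apply in_map_iff in Hw as [u [<- Hu]].
    rewrite <- (elim_kernel d f x0 (elim a x0 u)) by now apply dot_elim_same.
    apply span_elim; [exact Hf0|].
    unfold elim at 1; rewrite vsub_vadd.
    replace (vadd u (vscal (-1) (vscal (dot d u x0 / dot d a x0) a)))
      with (vadd (vscal (- (dot d u x0 / dot d a x0)) a) u) by (vext; ring).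
    apply span_comb; now apply HU.
Qed.

Lemma spanned_by_dim {d} (U : list (point d)) : spanned_by d U.
Proof.
  exists (map ebas (fins d)); split; [now rewrite length_map, length_fins|].
  intros u _.
  assert (H : forall l, NoDup l -> exists v, span (map ebas l) v /\
            forall k, v k = if in_dec Fin.eq_dec k l then u k else 0).
  { induction l as [|j l IH]; intros Hl.
    - exists vzero; split; [constructor|]; intro k.
      now destruct (in_dec Fin.eq_dec k []).
    - inversion Hl as [|? ? Hj Hl']; subst.
      destruct (IH Hl') as [v [Hv Hk]].
      exists (vadd (vscal (u j) (ebas j)) v); split.
      + constructor; [now left|]; clear -Hv.
        induction Hv; constructor; [now right|assumption].
      + intro k; unfold vadd, vscal, ebas; rewrite Hk.
        destruct (Fin.eq_dec j k) as [E|E], (in_dec Fin.eq_dec k l) as [E1|E1],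
          (in_dec Fin.eq_dec k (j :: l)) as [E2|E2]; subst; simpl in E2; try tauto; lra. }
  destruct (H (fins d) (NoDup_fins d)) as [v [Hv Hk]].
  replace u with v; [exact Hv|].
  apply functional_extensionality; intro k; rewrite Hk.
  destruct (in_dec Fin.eq_dec k (fins d)) as [_|E]; [reflexivity|].
  contradiction E; apply in_fins.
Qed.

Lemma csum_elim d (a x0 : point d) Z :
  csum (map (fun cz => (fst cz, elim a x0 (snd cz))) Z) = elim a x0 (csum Z).
Proof.
  induction Z as [|[c z] Z IH]; simpl; [now rewrite elim_zero|].
  now rewrite IH, elim_add.
Qed.

Lemma csum_dot_le d (Z : list (R * point d)) x M : 0 <= M ->
  (forall cz, In cz Z -> 0 <= fst cz /\ dot d (snd cz) x <= M) ->
  dot d (csum Z) x <= fold_right (fun cz acc => fst cz + acc) 0 Z * M.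
Proof.
  intros HM; induction Z as [|[c z] Z IH]; intros H; simpl; dots; [lra|].
  specialize (IH (fun cz h => H cz (or_intror h))).
  destruct (H (c, z) (or_introl eq_refl)) as [H1 H2]; simpl in *; nra.
Qed.

(* Bartl's proof of Farkas' lemma; every use of a new vector lowers the
   dimension by one, which yields the bound of Caratheodory's theorem. *)
Lemma farkas_caratheodory {d} n (U : list (point d)) gamma :
  spanned_by n (gamma :: U) ->
  (forall x, (forall u, In u U -> dot d u x <= 0) -> dot d gamma x <= 0) ->
  exists Z, (length Z <= n)%nat /\
    (forall cz, In cz Z -> 0 <= fst cz /\ In (snd cz) U) /\ gamma = csum Z.
Proof.
  remember (length U) as N eqn:HN; revert n U gamma HN.
  induction N as [|N IH]; intros n U gamma HN Hdim Himp.
  - destruct U; [|discriminate HN]; exists []; split; [simpl; lia|split; [intros ? []|]].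
    apply dot_self_zero, Himp; intros ? [].
  - destruct U as [|a U]; [discriminate HN|]; injection HN as HN.
    destruct (classic (forall x, (forall u, In u U -> dot d u x <= 0) -> dot d gamma x <= 0))
      as [Hc|Hc].
    + destruct (IH n U gamma HN) as [Z [HZ1 [HZ2 HZ3]]]; [|exact Hc|].
      * destruct Hdim as [F [HF HU]]; exists F; split; [exact HF|].
        intros u [<-|Hu]; apply HU; simpl; auto.
      * exists Z; split; [exact HZ1|split; [|exact HZ3]].
        intros cz Hcz; split; [|right]; now apply HZ2.
    (* Here [a] is indispensable: [x0] separates [gamma] from the remaining vectors, so [a] must be
       positive at [x0]. *)
    + apply not_all_ex_not in Hc as [x0 Hx0].
      apply imply_to_and in Hx0 as [Hx0 Hg]; apply Rnot_le_lt in Hg.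
      assert (Ha : 0 < dot d a x0).
      { apply Rnot_le_lt; intros Ha.
        assert (dot d gamma x0 <= 0); [|lra].
        apply Himp; intros u [<-|Hu]; auto. }
      destruct (spanned_by_elim n (gamma :: a :: U) a x0) as [n' [-> Hdim']];
        [exact Hdim|simpl; auto|lra|].
      destruct (IH n' (map (elim a x0) U) (elim a x0 gamma)) as [Z' [HZ1 [HZ2 HZ3]]].
      { now rewrite length_map. }
      { destruct Hdim' as [F [HF HU]]; exists F; split; [exact HF|].
        intros u [<-|Hu]; apply HU; simpl; auto. }
      (* The point [x'] is [x] moved along [x0] until [a] vanishes; evaluating a projected
         functional at [x] amounts to evaluating the original one at [x']. *)
      { intros x Hx; set (x' := vsub x (vscal (dot d a x / dot d a x0) x0)).
        assert (E : forall u, dot d (elim a x0 u) x = dot d u x').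
        { intro u; unfold x', elim; dots; field; lra. }
        rewrite E; apply Himp; intros u [<-|Hu].
        - unfold x'; dots; apply Req_le; field; lra.
        - rewrite <- E; apply Hx, in_map, Hu. }
      assert (HZ : exists Z, Z' = map (fun cz => (fst cz, elim a x0 (snd cz))) Z /\
                forall cz, In cz Z -> 0 <= fst cz /\ In (snd cz) U).
      { clear HZ1 HZ3; induction Z' as [|[c z] Z' IHZ]; [now exists []|].
        destruct IHZ as [Z [-> HZ]]; [intros cz h; apply HZ2; now right|].
        destruct (HZ2 (c, z) (or_introl eq_refl)) as [Hc Hz]; simpl in Hc, Hz.
        apply in_map_iff in Hz as [u [<- Hu]].
        exists ((c, u) :: Z); split; [reflexivity|].
        intros cz [<-|h]; [now split|now apply HZ]. }
      destruct HZ as [Z [-> HZ]]; rewrite length_map in HZ1; rewrite csum_elim in HZ3.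
      (* Lifting [Z] back leaves a multiple of [a] to be added. Its coefficient is positive because
         [gamma] is positive at [x0] and [csum Z] is not. *)
      assert (Hneg : dot d (csum Z) x0 <= 0).
      { rewrite <- (Rmult_0_r (fold_right (fun cz acc => fst cz + acc) 0 Z)).
        apply csum_dot_le; [lra|].
        intros cz h; split; [now apply HZ|apply Hx0; now apply HZ]. }
      exists (((dot d gamma x0 - dot d (csum Z) x0) / dot d a x0, a) :: Z).
      split; [simpl; lia|split].
      * intros cz [<-|h]; simpl.
        -- split; [|now left]; apply Rlt_le, Rdiv_lt_0_compat; lra.
        -- split; [|right]; now apply HZ.
      * simpl; vext.
        pose proof (f_equal (fun v => v i) HZ3) as E; unfold elim, vsub, vscal in E.
        unfold Rdiv in *; lra.
Qed.

(** Being a basis is expressed dually: whatever annihilates [B] annihilates [U]. A functional [a]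
    that is nonzero at some [x0] is put into [B], and projection along [a] lowers the dimension
    bound for the rest. *)
Lemma exists_basis {d} n (U : list (point d)) : spanned_by n U ->
  exists B, incl B U /\ (length B <= n)%nat /\
    forall x, (forall b, In b B -> dot d b x = 0) -> forall u, In u U -> dot d u x = 0.
Proof.
  revert U; induction n as [n IHn] using (well_founded_induction Wf_nat.lt_wf); intros U Hdim.
  destruct (classic (forall u, In u U -> forall x, dot d u x = 0)) as [H|H].
  - exists []; split; [intros ? []|split; [simpl; lia|]]; auto.
  - apply not_all_ex_not in H as [a H]; apply imply_to_and in H as [Ha H].
    apply not_all_ex_not in H as [x0 H0].
    destruct (spanned_by_elim n U a x0 Hdim Ha H0) as [n' [-> Hdim']].
    destruct (IHn n' ltac:(lia) _ Hdim') as [B' [HB1 [HB2 HB3]]].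
    assert (HB : exists B, B' = map (elim a x0) B /\ incl B U).
    { clear HB2 HB3; induction B' as [|b B' IHB]; [exists []; split; [reflexivity|intros ? []]|].
      destruct IHB as [B [-> HB]]; [intros w h; apply HB1; now right|].
      pose proof (HB1 b (or_introl eq_refl)) as Hb.
      apply in_map_iff in Hb as [u [<- Hu]].
      exists (u :: B); split; [reflexivity|]; intros w [<-|h]; [exact Hu|now apply HB]. }
    destruct HB as [B [-> HB]]; rewrite length_map in HB2.
    exists (a :: B); split; [|split; [simpl; lia|]].
    + intros w [<-|h]; [exact Ha|now apply HB].
    + intros x Hx u Hu.
      assert (E : dot d (elim a x0 u) x = 0).
      { apply HB3; [|now apply in_map].
        intros w h; apply in_map_iff in h as [b [<- Hb]].
        unfold elim; dots; rewrite (Hx a), (Hx b) by (simpl; auto); ring. }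
      unfold elim in E; rewrite dot_vsub_l, dot_vscal_l, (Hx a) in E by (simpl; auto); lra.
Qed.

(** The dual form, by Farkas' lemma, of the requirement that nonnegative combinations of [U] fill
    the space. *)
Definition pos_spanning {d} (U : list (point d)) : Prop :=
  forall x, (forall u, In u U -> dot d u x <= 0) -> x = vzero.

(* A basis [B] together with [d] vectors whose cone contains [- sum B]. *)
Lemma pos_spanning_reduce {d} (U : list (point d)) : pos_spanning U ->
  exists U', incl U' U /\ (length U' <= 2 * d)%nat /\ pos_spanning U'.
Proof.
  intros HU.
  destruct (exists_basis d U (spanned_by_dim U)) as [B [HB1 [HB2 HB3]]].
  set (S := csum (map (fun b => (1, b)) B)).
  destruct (farkas_caratheodory d U (vscal (-1) S) (spanned_by_dim _)) as [Z [HZ1 [HZ2 HZ3]]].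
  { intros x Hx; rewrite (HU x Hx); dots; lra. }
  exists (B ++ map snd Z); split; [|split].
  - apply incl_app; [exact HB1|].
    intros z Hz; apply in_map_iff in Hz as [cz [<- Hcz]]; now apply HZ2.
  - rewrite length_app, length_map; lia.
  - intros x Hx.
    (* Since [-S] is a nonnegative combination from [Z], the sum [S] is nonnegative at [x]; its
       terms are nonpositive there, so each of them vanishes, and with the basis all of [U] vanishes
       at [x]. *)
    assert (HS : 0 <= dot d S x).
    { assert (H : dot d (vscal (-1) S) x <= 0).
      { rewrite HZ3, <- (Rmult_0_r (fold_right (fun cz acc => fst cz + acc) 0 Z)).
        apply csum_dot_le; [lra|].
        intros cz h; split; [now apply HZ2|apply Hx, in_app_iff; right; now apply in_map]. }
      rewrite dot_vscal_l in H; lra. }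
    apply HU; intros u Hu; apply Req_le, HB3; [|exact Hu].
    assert (HBx : forall b, In b B -> dot d b x <= 0)
      by (intros; apply Hx, in_app_iff; now left).
    clear -HS HBx; subst S; induction B as [|b B IH]; [intros ? []|].
    simpl in HS; rewrite dot_vadd_l, dot_vscal_l in HS.
    pose proof (HBx b (or_introl eq_refl)) as Hb.
    assert (HT : dot d (csum (map (fun b => (1, b)) B)) x <= 0).
    { rewrite <- (Rmult_0_r (fold_right (fun cz acc => fst cz + acc) 0
                                (map (fun b => (1, b)) B))).
      apply csum_dot_le; [lra|].
      intros cz h; apply in_map_iff in h as [b' [<- h]]; simpl; split; [lra|].
      apply HBx; now right. }
    intros b' [<-|h]; [lra|].
    apply IH; [lra| |exact h].
    intros b'' h'; apply HBx; now right.
Qed.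

(** Each coordinate functional and its opposite is a nonnegative combination of [U], hence bounded
    above by [c] times the sum of its coefficients. *)
Lemma pos_spanning_bounded {d} (U : list (point d)) c : pos_spanning U -> 0 <= c ->
  exists M, 0 <= M /\
    forall y, (forall u, In u U -> dot d u y <= c) -> forall i, Rabs (y i) <= M.
Proof.
  intros HU Hc.
  assert (H : forall w : point d, exists M, forall y,
            (forall u, In u U -> dot d u y <= c) -> dot d w y <= M).
  { intro w; destruct (farkas_caratheodory d U w (spanned_by_dim _)) as [Z [_ [HZ ->]]].
    - intros x Hx; rewrite (HU x Hx); dots; lra.
    - eexists; intros y Hy; apply csum_dot_le; [exact Hc|].
      intros cz h; split; [now apply HZ|apply Hy; now apply HZ]. }
  assert (H' : forall l : list (Fin.t d), exists M, 0 <= M /\ forall y,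
            (forall u, In u U -> dot d u y <= c) -> forall i, In i l -> Rabs (y i) <= M).
  { induction l as [|i l [M [HM IH]]]; [exists 0; split; [lra|intros ? ? ? []]|].
    destruct (H (ebas i)) as [M1 H1], (H (vscal (-1) (ebas i))) as [M2 H2].
    exists (Rmax M (Rmax M1 M2)); split; [eapply Rle_trans; [exact HM|apply Rmax_l]|].
    intros y Hy j [<-|Hj].
    - specialize (H1 y Hy); specialize (H2 y Hy).
      rewrite dot_vscal_l in H2; rewrite dot_comm, dot_ebas in H1, H2.
      pose proof (Rmax_r M (Rmax M1 M2)); pose proof (Rmax_l M1 M2); pose proof (Rmax_r M1 M2).
      apply Rabs_le; lra.
    - eapply Rle_trans; [now apply IH|apply Rmax_l]. }
  destruct (H' (fins d)) as [M [HM HM']]; exists M; split; [exact HM|].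
  intros y Hy i; apply HM'; [exact Hy|apply in_fins].
Qed.

(** * Assembling the covering *)

(** For [c >= 0] the set where the gauge is at most [c] is the polytope cut out by [u.p <= c]. Since
    the fold starts at 0, only a positive value is sure to come from a member of [U]. *)
Definition gauge {d} (U : list (point d)) (p : point d) : R :=
  fold_right (fun u r => Rmax (dot d u p) r) 0 U.

Lemma gauge_ge {d} (U : list (point d)) p u : In u U -> dot d u p <= gauge U p.
Proof.
  induction U as [|v U IH]; simpl; [intros []|intros [->|H]].
  - apply Rmax_l.
  - eapply Rle_trans; [now apply IH|apply Rmax_r].
Qed.

Lemma gauge_attained {d} (U : list (point d)) p :
  0 < gauge U p -> exists u, In u U /\ dot d u p = gauge U p.
Proof.
  induction U as [|v U IH]; simpl; intros H; [lra|].
  unfold Rmax in *; destruct (Rle_dec (dot d v p) (gauge U p)).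
  - destruct (IH H) as [u [Hu E]]; exists u; auto.
  - exists v; auto.
Qed.

Lemma gauge_bounded {d} (U : list (point d)) M : 0 <= M ->
  exists C, forall p, (forall i, Rabs (p i) <= M) -> gauge U p <= C.
Proof.
  intros HM; induction U as [|v U [C HC]]; simpl; [exists 0; intros; lra|].
  exists (Rmax (norm1 v * M) C); intros p Hp; apply Rmax_lub.
  - eapply Rle_trans; [|apply Rmax_l].
    eapply Rle_trans; [apply Rle_abs|now apply dot_bound].
  - eapply Rle_trans; [now apply HC|apply Rmax_r].
Qed.

(** * Half-spaces, the homothets that imitate them, and multiplicities *)

Definition halfspaces_at {d} (a : R) (U : list (point d)) (p : point d) : nat :=
  length (filter (fun u => if Rle_dec a (dot d u p) then true else false) U).

Lemma halfspaces_at_zero {d} a (U : list (point d)) p :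
  gauge U p < a -> halfspaces_at a U p = 0%nat.
Proof.
  intros H; unfold halfspaces_at; induction U as [|u U IH]; simpl in *; [reflexivity|].
  pose proof (Rmax_l (dot d u p) (gauge U p)); pose proof (Rmax_r (dot d u p) (gauge U p)).
  destruct (Rle_dec a (dot d u p)); [lra|apply IH; lra].
Qed.

(** The gap between [a] and [a'] absorbs the curvature of the boundary. Every size beyond [Lam] has
    to work, because the family is only known to be unbounded and its sizes cannot be prescribed. *)
Definition locally_halfspace {d} (K : point d -> Prop) (n : point d) : Prop :=
  forall a a' M, a < a' -> exists Lam, forall l, 0 < l -> Lam <= l -> exists x,
    (forall p, translated_homothet K l x p -> a <= dot d n p) /\
    (forall p, a' <= dot d n p -> (forall i, Rabs (p i) <= M) ->
       translated_homothet K l x p).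

(** The homothet is placed with the image of [b] at [a n]. A point [p] then corresponds to [b + t w]
    with [t = 1 / l] and [w = p - a n], whose height [n.w] is at least [a' - a] when [n.p >= a']. *)
Lemma locally_halfspace_at {d} (K : point d -> Prop) n b :
  dot d n n = 1 -> (forall z, K z -> dot d n b <= dot d n z) ->
  (forall delta B, 0 < delta -> 0 <= B -> exists t0, 0 < t0 /\
     forall t w, 0 < t <= t0 -> delta <= dot d n w -> (forall i, Rabs (w i) <= B) ->
       K (vadd b (vscal t w))) ->
  locally_halfspace K n.
Proof.
  intros Hn Hsup Hloc a a' M Ha.
  destruct (coord_bound d n) as [N [HN HnN]].
  destruct (Hloc (a' - a) (Rabs M + Rabs a * N)) as [t0 [Ht0 HK]]; [lra| |].
  { pose proof (Rabs_pos M); pose proof (Rabs_pos a); nra. }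
  exists (/ t0); intros l Hl Hlt.
  exists (vsub (vscal a n) (vscal l b)); split.
  - intros p [k [Hk Hp]].
    replace p with (vadd (vsub (vscal a n) (vscal l b)) (vscal l k)) by (vext; now rewrite Hp).
    dots; specialize (Hsup k Hk); rewrite Hn; nra.
  - intros p Hp HpM; exists (vadd b (vscal (/ l) (vsub p (vscal a n)))); split.
    + apply HK.
      * split; [now apply Rinv_0_lt_compat|].
        rewrite <- (Rinv_inv t0); apply Rinv_le_contravar; [now apply Rinv_0_lt_compat|exact Hlt].
      * dots; rewrite Hn; lra.
      * intro i; unfold vsub, vscal, Rminus.
        eapply Rle_trans; [apply Rabs_triang|]; rewrite Rabs_Ropp, Rabs_mult.
        pose proof (HpM i); pose proof (HnN i); pose proof (Rle_abs M);
          pose proof (Rabs_pos a); nra.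
    + intro i; unfold vadd, vsub, vscal; field; lra.
Qed.

Definition covers {d} (K : point d -> Prop) (lam : nat -> R) (p : point d)
  (t : nat * point d) : bool :=
  if excluded_middle_informative (translated_homothet K (lam (fst t)) (snd t) p)
  then true else false.

Definition mult {d} (K : point d -> Prop) (lam : nat -> R) (L : list (nat * point d))
  (p : point d) : nat :=
  length (filter (covers K lam p) L).

Lemma covers_true {d} (K : point d -> Prop) lam p t :
  covers K lam p t = true <-> translated_homothet K (lam (fst t)) (snd t) p.
Proof.
  unfold covers; destruct (excluded_middle_informative _); split; auto; easy.
Qed.

Lemma mult_app {d} (K : point d -> Prop) lam L1 L2 p :
  mult K lam (L1 ++ L2) p = (mult K lam L1 p + mult K lam L2 p)%nat.
Proof. unfold mult; now rewrite filter_app, length_app. Qed.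

Lemma mult_le_length {d} (K : point d -> Prop) lam L p :
  (mult K lam L p <= length L)%nat.
Proof. apply filter_length_le. Qed.

Lemma mult_zero {d} (K : point d -> Prop) lam L p :
  (forall t, In t L -> ~ translated_homothet K (lam (fst t)) (snd t) p) ->
  mult K lam L p = 0%nat.
Proof.
  unfold mult; induction L as [|t L IH]; simpl; intros H; [reflexivity|].
  destruct (covers K lam p t) eqn:E.
  - apply covers_true in E; exfalso; apply (H t); auto.
  - apply IH; auto.
Qed.

Lemma homothet_bounded {d} (K : point d -> Prop) l x : bounded_set K -> 0 < l ->
  exists M, 0 <= M /\ forall p, translated_homothet K l x p -> forall i, Rabs (p i) <= M.
Proof.
  intros [M HM] Hl; destruct (coord_bound d x) as [Mx [HMx Hx]].
  exists (Mx + l * Rabs M); split.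
  - pose proof (Rabs_pos M); nra.
  - intros p [k [Hk Hp]] i; rewrite Hp.
    eapply Rle_trans; [apply Rabs_triang|]; rewrite Rabs_mult, (Rabs_pos_eq l) by lra.
    pose proof (HM k Hk i); pose proof (Rle_abs M); specialize (Hx i); nra.
Qed.

Lemma family_gauge_bounded {d} (K : point d -> Prop) lam (U : list (point d)) L :
  bounded_set K -> (forall n, 0 < lam n) ->
  exists S, forall p, S <= gauge U p -> mult K lam L p = 0%nat.
Proof.
  intros HK Hpos.
  assert (H : exists S, forall p t, In t L ->
            translated_homothet K (lam (fst t)) (snd t) p -> gauge U p < S).
  { induction L as [|t L [S HS]]; [exists 0; intros ? ? []|].
    destruct (homothet_bounded K _ (snd t) HK (Hpos (fst t))) as [M [HM HM']].
    destruct (gauge_bounded U M HM) as [C HC].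
    exists (Rmax S (C + 1)); intros p t' [<-|Ht] Hp.
    - pose proof (HC p (HM' p Hp)); pose proof (Rmax_r S (C + 1)); lra.
    - eapply Rlt_le_trans; [eapply HS; eauto|apply Rmax_l]. }
  destruct H as [S HS]; exists S; intros p Hp; apply mult_zero; intros t Ht Hc.
  specialize (HS p t Ht Hc); lra.
Qed.

Lemma fresh_large (lam : nat -> R) (hunb : forall M : R, exists n, M < lam n) used Lam :
  exists n, ~ In n used /\ Lam <= lam n.
Proof.
  assert (H : exists B, Lam <= B /\ forall n, In n used -> lam n <= B).
  { induction used as [|n used [B [HB1 HB2]]]; [exists Lam; split; [lra|intros ? []]|].
    exists (Rmax B (lam n)); split; [eapply Rle_trans; [exact HB1|apply Rmax_l]|].
    intros m [<-|Hm]; [apply Rmax_r|eapply Rle_trans; [now apply HB2|apply Rmax_l]]. }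
  destruct H as [B [HB1 HB2]]; destruct (hunb B) as [n Hn].
  exists n; split; [|lra]; intros Hin; specialize (HB2 n Hin); lra.
Qed.

(** One fresh huge body is spent on each [u] in [U]. It stays inside its half-space [u.p >= a], so
    counting bodies at a point is bounded by counting half-spaces. *)
Lemma halfspace_round {d} (K : point d -> Prop) lam (U : list (point d)) a a' M used :
  (forall n, 0 < lam n) -> (forall M : R, exists n, M < lam n) ->
  (forall u, In u U -> locally_halfspace K u) -> a < a' -> NoDup used ->
  exists T, NoDup (map fst T ++ used) /\
    (forall p u, In u U -> a' <= dot d u p -> (forall i, Rabs (p i) <= M) ->
       exists t, In t T /\ translated_homothet K (lam (fst t)) (snd t) p) /\
    (forall p, (mult K lam T p <= halfspaces_at a U p)%nat).
Proof.
  intros Hpos Hunb HU Ha Hused; induction U as [|u U IH].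
  - exists []; split; [exact Hused|split; [intros ? ? []|]].
    intros p; unfold mult; simpl; lia.
  - destruct IH as [T [HT1 [HT2 HT3]]]; [intros; apply HU; now right|].
    destruct (HU u (or_introl eq_refl) a a' M Ha) as [Lam HLam].
    destruct (fresh_large lam Hunb (map fst T ++ used) Lam) as [n [Hn Hln]].
    destruct (HLam (lam n) (Hpos n) Hln) as [x [Hx1 Hx2]].
    exists ((n, x) :: T); split; [|split].
    + simpl; now constructor.
    + intros p v [<-|Hv] Hvp Hp.
      * exists (n, x); split; [now left|now apply Hx2].
      * destruct (HT2 p v Hv Hvp Hp) as [t [Ht Hc]]; exists t; split; [now right|exact Hc].
    + intros p; specialize (HT3 p); unfold mult, halfspaces_at in *; simpl.
      destruct (covers K lam p (n, x)) eqn:E.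
      * apply covers_true in E; apply Hx1 in E.
        destruct (Rle_dec a (dot d u p)); [simpl; lia|contradiction].
      * destruct (Rle_dec a (dot d u p)); simpl; lia.
Qed.

Lemma place_far {d} (K : point d -> Prop) lam (U : list (point d)) u k S used :
  bounded_set K -> (forall n, 0 < lam n) -> In u U -> 0 < dot d u u -> NoDup used ->
  exists E, NoDup (map fst E ++ used) /\ In k (map fst E ++ used) /\
    (length E <= 1)%nat /\ forall p, gauge U p < S -> mult K lam E p = 0%nat.
Proof.
  intros HK Hpos Hu Huu Hused; destruct (in_dec Nat.eq_dec k used) as [Hk|Hk].
  - exists []; simpl; repeat split; auto.
  - destruct (homothet_bounded K (lam k) vzero HK (Hpos k)) as [M [HM HM']].
    (* At the translation [tau u] the functional [u] equals [S + norm1 u * M], and over the body it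
       varies by at most [norm1 u * M]; so [u], and with it the gauge, is at least [S] on the whole
       body. *)
    set (tau := (S + norm1 u * M) / dot d u u).
    exists [(k, vscal tau u)]; simpl; split; [now constructor|split; [now left|split; [lia|]]].
    intros p Hp; apply mult_zero; intros t [<-|[]] [q [Hq Hpq]]; simpl in Hpq.
    assert (E : p = vadd (vscal tau u) (vscal (lam k) q)) by (vext; apply Hpq).
    pose proof (gauge_ge U p u Hu) as Hg; rewrite E, dot_vadd_r, dot_vscal_r in Hg at 1.
    assert (Htau : tau * dot d u u = S + norm1 u * M) by (unfold tau; field; lra).
    assert (Hb : Rabs (dot d u (vscal (lam k) q)) <= norm1 u * M).
    { apply dot_bound, HM'; exists q; split; [exact Hq|].
      intro i; unfold vzero, vscal; ring. }
    pose proof (Rle_abs (- dot d u (vscal (lam k) q))); rewrite Rabs_Ropp in *; lra.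
Qed.

(** Here [r] is the level up to which all is covered and [s] a level beyond everything placed. The
    last clause reserves room for the next round, which starts at level [r - 1]; the bound [2 <= r]
    keeps that level positive. *)
Definition partial_covering {d} (K : point d -> Prop) lam (U : list (point d)) (h : nat)
  (L : list (nat * point d)) (r s : R) : Prop :=
  NoDup (map fst L) /\ 2 <= r /\
  (forall p, gauge U p <= r ->
     exists t, In t L /\ translated_homothet K (lam (fst t)) (snd t) p) /\
  (forall p, s <= gauge U p -> mult K lam L p = 0%nat) /\
  (forall p, (mult K lam L p <= 2 * h)%nat) /\
  (forall p, r - 1 <= gauge U p -> (mult K lam L p <= h)%nat).

Section Assembly.
Context {d : nat} (K : point d -> Prop) (lam : nat -> R) (U : list (point d)) (h : nat).
Context (HK : convex_body K) (hpos : forall n, 0 < lam n)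
  (hunb : forall M : R, exists n, M < lam n) (hd : (1 <= d)%nat) (hh : (1 <= h)%nat)
  (HU : forall u, In u U -> locally_halfspace K u) (Hpos : pos_spanning U)
  (Hh : forall a p, 0 < a -> (halfspaces_at a U p <= h)%nat).

Lemma initial_covering : exists L r s, partial_covering K lam U h L r s.
Proof.
  destruct HK as [_ [_ [Hbd [x0 [r [Hr Hball]]]]]].
  destruct (pos_spanning_bounded U 2 Hpos ltac:(lra)) as [M [HM HM']].
  (* The inner cube of the homothet has half-side [lam n * r], at least [2 * M]. The factor 2 gives
     the strict inequality needed for the open cube, except for [M = 0], where [lam n * r > 0]
     suffices. *)
  destruct (fresh_large lam hunb [] (2 * M / r)) as [n [_ Hn]].
  set (L := [(n, vscal (- lam n) x0)]).
  destruct (family_gauge_bounded K lam U L Hbd hpos) as [s Hs].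
  assert (H1 : forall p, (mult K lam L p <= 1)%nat) by (intro; apply (mult_le_length K lam L)).
  exists L, 2, s; repeat split.
  - simpl; constructor; [intros []|constructor].
  - lra.
  - intros p Hp; exists (n, vscal (- lam n) x0); split; [now left|]; simpl.
    pose proof (hpos n) as Hl.
    exists (fun i => x0 i + p i / lam n); split.
    + apply Hball; intro i.
      replace (x0 i + p i / lam n - x0 i) with (p i * / lam n) by (unfold Rdiv; ring).
      rewrite Rabs_mult, (Rabs_pos_eq (/ lam n)) by (apply Rlt_le, Rinv_0_lt_compat, Hl).
      assert (Hpi : Rabs (p i) <= M).
      { apply HM'; intros u Hu; pose proof (gauge_ge U p u Hu); lra. }
      apply Rmult_lt_reg_r with (lam n); [exact Hl|].
      rewrite Rmult_assoc, Rinv_l, Rmult_1_r by lra.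
      assert (2 * M <= lam n * r).
      { apply Rmult_le_reg_r with (/ r); [now apply Rinv_0_lt_compat|].
        rewrite (Rmult_assoc (lam n)), Rinv_r, Rmult_1_r by lra; exact Hn. }
      destruct (Req_dec M 0); nra.
    + intro i; unfold vscal; field; lra.
  - exact Hs.
  - intro p; specialize (H1 p); lia.
  - intros p _; specialize (H1 p); lia.
Qed.

(** Three families coexist: the old [L], the at most one body [E] carrying index [k], and the new
    round [T]. Below level [r - 1] only [L] is met; from there to [s1] only [L] and [T], each at
    most [h] times; from [s1] on only [T] and [E], with [E] counting at most [1 <= h]. *)
Lemma extend_covering k L r s : partial_covering K lam U h L r s ->
  exists L' r' s', partial_covering K lam U h L' r' s' /\ r + 1 <= r' /\
    incl L L' /\ In k (map fst L').
Proof.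
  intros [HL1 [Hr [HL2 [HL3 [HL4 HL5]]]]].
  pose proof HK as [_ [_ [Hbd _]]].
  (* If all members of [U] were zero, positive spanning would force the first basis vector to
     vanish. *)
  assert (Hu : exists u, In u U /\ 0 < dot d u u).
  { apply NNPP; intros Hn.
    destruct d as [|n]; [lia|].
    assert (E : ebas (@Fin.F1 n) = vzero).
    { apply Hpos; intros u Hu; apply Req_le.
      replace u with (@vzero (S n)); [apply dot_vzero_l|].
      symmetry; apply dot_self_zero, Rnot_lt_le; intros Hlt; apply Hn; now exists u. }
    apply (f_equal (fun v => v Fin.F1)) in E; unfold ebas, vzero in E.
    destruct (Fin.eq_dec Fin.F1 Fin.F1); [lra|congruence]. }
  destruct Hu as [u [Hu Huu]].
  set (s1 := Rmax r s).
  destruct (place_far K lam U u k s1 _ Hbd hpos Hu Huu HL1) as [E [HE1 [HE2 [HE3 HE4]]]].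
  destruct (family_gauge_bounded K lam U E Hbd hpos) as [q Hq].
  (* From level [r' - 1] on both [L] and [E] have ended, so only [T] is met there, as the last
     clause for [r'] demands. *)
  set (r' := Rmax q s1 + 1).
  pose proof (Rmax_l r s); pose proof (Rmax_r r s); fold s1 in H, H0.
  pose proof (Rmax_l q s1); pose proof (Rmax_r q s1).
  destruct (pos_spanning_bounded U r' Hpos ltac:(unfold r'; lra)) as [M [_ HM]].
  destruct (halfspace_round K lam U (r - 1) r M _ hpos hunb HU ltac:(lra) HE1)
    as [T [HT1 [HT2 HT3]]].
  assert (HTh : forall p, (mult K lam T p <= h)%nat).
  { intro p; eapply Nat.le_trans; [apply HT3|apply Hh; lra]. }
  assert (HT0 : forall p, gauge U p < r - 1 -> mult K lam T p = 0%nat).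
  { intros p Hp; specialize (HT3 p); rewrite halfspaces_at_zero in HT3 by exact Hp; lia. }
  assert (HEl : forall p, (mult K lam E p <= 1)%nat).
  { intro p; eapply Nat.le_trans; [apply mult_le_length|exact HE3]. }
  set (L' := T ++ E ++ L).
  destruct (family_gauge_bounded K lam U L' Hbd hpos) as [s' Hs'].
  exists L', r', s'; split; [|split; [unfold r'; lra|split]].
  - split; [unfold L'; rewrite !map_app; exact HT1|].
    split; [unfold r'; lra|]; split; [|split; [exact Hs'|split]].
    + intros p Hp; destruct (Rle_dec (gauge U p) r) as [Hc|Hc].
      * destruct (HL2 p Hc) as [t [Ht Htp]]; exists t; split; [|exact Htp].
        unfold L'; rewrite !in_app_iff; auto.
      (* Between levels [r] and [r'] the functional attaining the gauge is at least [r] at [p], so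
         its body in [T] covers [p]. *)
      * destruct (gauge_attained U p ltac:(lra)) as [v [Hv Hvp]].
        destruct (HT2 p v Hv) as [t [Ht Htp]]; [lra| |].
        { apply HM; intros w Hw; pose proof (gauge_ge U p w Hw); lra. }
        exists t; split; [|exact Htp]; unfold L'; rewrite !in_app_iff; auto.
    + intros p; unfold L'; rewrite !mult_app.
      specialize (HTh p); specialize (HEl p); specialize (HL4 p).
      destruct (Rlt_le_dec (gauge U p) s1) as [Hc|Hc].
      * rewrite (HE4 p Hc).
        destruct (Rlt_le_dec (gauge U p) (r - 1)) as [Hc'|Hc'].
        -- rewrite (HT0 p Hc'); lia.
        -- specialize (HL5 p Hc'); lia.
      * rewrite (HL3 p) by lra; lia.
    + intros p Hp; unfold L'; rewrite !mult_app.
      rewrite (HL3 p), (Hq p) by (unfold r' in Hp; lra); specialize (HTh p); lia.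
  - unfold L'; intros t Ht; rewrite !in_app_iff; auto.
  - unfold L'; rewrite !map_app, in_app_iff; right; now rewrite <- map_app in *.
Qed.

(** The stages are extended forever, step [k] making sure that index [k] is placed. Placed bodies
    never move, and the covered levels grow at least like the stage number, so the union of the
    stages is the covering. *)
Lemma covering_from_halfspaces : translative_covering_mult K lam (2 * h).
Proof.
  set (good := fun st : list (nat * point d) * R * R =>
                 partial_covering K lam U h (fst (fst st)) (snd (fst st)) (snd st)).
  assert (Hstep : forall (k : nat) (st : {st | good st}), exists st' : {st | good st},
            snd (fst (proj1_sig st)) + 1 <= snd (fst (proj1_sig st')) /\
            incl (fst (fst (proj1_sig st))) (fst (fst (proj1_sig st'))) /\
            In k (map fst (fst (fst (proj1_sig st'))))).
  { intros k [[[L r] s] Hst].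
    destruct (extend_covering k L r s Hst) as [L' [r' [s' [H1 H2]]]].
    exists (exist good (L', r', s') H1); exact H2. }
  assert (Hinit : exists st, good st).
  { destruct initial_covering as [L [r [s H]]]; now exists (L, r, s). }
  apply constructive_indefinite_description in Hinit as [st0 Hst0].
  set (step := fun k st => proj1_sig (constructive_indefinite_description _ (Hstep k st))).
  set (stage := fix stage n := match n with
                               | O => exist good st0 Hst0
                               | S n => step n (stage n)
                               end).
  set (LL := fun n => fst (fst (proj1_sig (stage n)))).
  set (rr := fun n => snd (fst (proj1_sig (stage n)))).
  assert (Hs : forall n, rr n + 1 <= rr (S n) /\ incl (LL n) (LL (S n)) /\
                         In n (map fst (LL (S n)))).
  { intro n; exact (proj2_sig (constructive_indefinite_description _ (Hstep n (stage n)))). }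
  assert (Hg : forall n, exists s, partial_covering K lam U h (LL n) (rr n) s).
  { intro n; exists (snd (proj1_sig (stage n))); exact (proj2_sig (stage n)). }
  assert (Hrr : forall n, INR n <= rr n).
  { induction n as [|n IH].
    - destruct (Hg 0%nat) as [s [_ [H _]]]; simpl; lra.
    - rewrite S_INR; destruct (Hs n) as [H _]; lra. }
  assert (Hmono : forall m n, (m <= n)%nat -> incl (LL m) (LL n)).
  { intros m n H; induction H as [|n H IH]; [apply incl_refl|].
    eapply incl_tran; [exact IH|apply Hs]. }
  assert (Hx : forall n, exists x, In (n, x) (LL (S n))).
  { intro n; destruct (Hs n) as [_ [_ H]]; apply in_map_iff in H as [[m x] [E H]].
    simpl in E; subst m; now exists x. }
  set (x := fun n => proj1_sig (constructive_indefinite_description _ (Hx n))).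
  assert (Hxin : forall n, In (n, x n) (LL (S n))).
  { intro n; exact (proj2_sig (constructive_indefinite_description _ (Hx n))). }
  exists x; split.
  - intro p; destruct (INR_unbounded (gauge U p)) as [k Hk].
    destruct (Hg k) as [s [_ [_ [Hc _]]]].
    destruct (Hc p) as [[n y] [Hin Hp]]; [specialize (Hrr k); lra|].
    exists n; simpl in Hp.
    (* Both positions of index [n] occur in one later stage, where indices do not repeat. *)
    replace (x n) with y; [exact Hp|].
    destruct (Hg (k + S n)%nat) as [s' [Hnd _]].
    pose proof (Hmono k (k + S n)%nat ltac:(lia) _ Hin) as H1.
    pose proof (Hmono (S n) (k + S n)%nat ltac:(lia) _ (Hxin n)) as H2.
    clear -Hnd H1 H2; induction (LL (k + S n)%nat) as [|[m z] L IH]; [destruct H1|].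
    simpl in Hnd; inversion Hnd as [|? ? Hm Hnd']; subst.
    destruct H1 as [E1|H1], H2 as [E2|H2].
    + congruence.
    + injection E1 as -> ->; contradiction Hm; now apply (in_map fst) in H2.
    + injection E2 as -> ->; contradiction Hm; now apply (in_map fst) in H1.
    + now apply IH.
  - intros p l Hl Hcov.
    (* Finitely many members all occur in a single stage, whose multiplicity bound then applies. *)
    assert (HN : exists N, forall n, In n l -> (S n <= N)%nat).
    { exists (S (list_max l)); intros n Hn.
      pose proof (proj1 (list_max_le l (list_max l)) (Nat.le_refl _)) as H.
      rewrite Forall_forall in H; specialize (H n Hn); lia. }
    destruct HN as [N HN]; destruct (Hg N) as [s [_ [_ [_ [_ [Hm _]]]]]].
    eapply Nat.le_trans; [|apply (Hm p)].
    unfold mult; rewrite <- (length_map fst).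
    apply NoDup_incl_length; [exact Hl|].
    intros n Hn; apply in_map_iff; exists (n, x n); split; [reflexivity|].
    apply filter_In; split.
    + apply (Hmono (S n) N); [now apply HN|apply Hxin].
    + apply covers_true; now apply Hcov.
Qed.

End Assembly.

(** * Boundary points touched by inscribed balls *)

Lemma abs_le_of_sqr_le a q : 0 <= q -> a * a <= q * q -> Rabs a <= q.
Proof. intros; apply Rabs_le; split; nra. Qed.

Lemma dot_self_continuous {d} (w : point d) eps : 0 < eps ->
  exists delta, 0 < delta /\ forall y, (forall i, Rabs (y i - w i) < delta) ->
    Rabs (dot d y y - dot d w w) < eps.
Proof.
  intros He; pose proof (norm1_nonneg d w) as Hn; pose proof (pos_INR d) as Hd.
  (* With [y = w + h] and the coordinates of [h] at most [k <= 1] in absolute value, the change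
     [2 w.h + h.h] is at most [k (2 norm1 w + d)]. *)
  set (B := 2 * norm1 w + INR d + 1).
  assert (HB : 1 <= B) by (unfold B; lra).
  exists (Rmin 1 (eps / B)); split; [apply Rmin_pos; [lra|apply Rdiv_lt_0_compat; lra]|].
  intros y Hy; set (k := Rmin 1 (eps / B)) in *; set (h := vsub y w).
  assert (Hk : 0 < k <= 1).
  { split; [apply Rmin_pos; [lra|apply Rdiv_lt_0_compat; lra]|apply Rmin_l]. }
  assert (HkB : k * B <= eps).
  { replace eps with (eps / B * B) by (field; lra).
    apply Rmult_le_compat_r; [lra|apply Rmin_r]. }
  assert (Hh : forall i, Rabs (h i) <= k) by (intro i; apply Rlt_le, Hy).
  replace y with (vadd w h) by (unfold h; vext; ring).
  dots; rewrite (dot_comm d h w).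
  pose proof (dot_bound d w h k Hh) as H1; pose proof (dot_self_bound d h k Hh ltac:(lra)) as H2.
  pose proof (dot_self_nonneg d h) as H3.
  assert (INR d * k * k <= INR d * k) by nra.
  pose proof (Rle_abs (dot d w h)); pose proof (Rle_abs (- dot d w h)).
  rewrite Rabs_Ropp in *; unfold B in HkB; apply Rabs_def1; nra.
Qed.

Lemma closed_ball_of_open {d} (K : point d -> Prop) p m : Defs.closed_set K -> 0 < m ->
  (forall y, dot d (vsub y p) (vsub y p) < m -> K y) ->
  forall y, dot d (vsub y p) (vsub y p) <= m -> K y.
Proof.
  intros Hcl Hm Hop y Hy; apply Hcl; intros eps He.
  destruct (coord_bound d (vsub y p)) as [M [HM HMy]].
  set (s := eps / (M + eps + 1)).
  assert (Hs : 0 < s < 1).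
  { unfold s; split; [apply Rdiv_lt_0_compat; lra|].
    apply Rmult_lt_reg_r with (M + eps + 1); [lra|].
    unfold Rdiv; rewrite Rmult_assoc, Rinv_l by lra; lra. }
  assert (HsM : s * (M + eps + 1) = eps) by (unfold s; field; lra).
  exists (vsub y (vscal s (vsub y p))); split.
  - apply Hop.
    replace (vsub (vsub y (vscal s (vsub y p))) p) with (vscal (1 - s) (vsub y p))
      by (vext; ring).
    rewrite dot_vscal_l, dot_vscal_r.
    pose proof (dot_self_nonneg d (vsub y p)).
    assert ((1 - s) * (1 - s) < 1) by nra; nra.
  - intro i.
    replace (y i - vsub y (vscal s (vsub y p)) i) with (s * vsub y p i)
      by (unfold vsub, vscal; ring).
    rewrite Rabs_mult, (Rabs_pos_eq s) by lra.
    specialize (HMy i); nra.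
Qed.

(* The largest ball centred at [p] inside [K] touches the boundary at [b]; a point
   [z] of [K] beyond the tangent hyperplane would put [b] in the interior of the
   convex hull of [z] and the ball. *)
Lemma inscribed_ball_touches {d} (K : point d -> Prop) p r y0 :
  convex K -> Defs.closed_set K -> 0 < r ->
  (forall y, dot d (vsub y p) (vsub y p) <= r * r -> K y) -> ~ K y0 ->
  exists b rho, 0 < rho /\ dot d (vsub b p) (vsub b p) = rho * rho /\
    rho * rho <= dot d (vsub y0 p) (vsub y0 p) /\
    (forall y, dot d (vsub y p) (vsub y p) <= rho * rho -> K y) /\
    (forall z, K z -> dot d (vsub b p) (vsub z b) <= 0).
Proof.
  intros Hcv Hcl Hr Hball Hy0.
  set (e := fun y => dot d (vsub y p) (vsub y p)).
  (* Negation turns the infimum of squared distances from [p] to the complement into a supremum;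
     [m = - l] is the squared radius of the largest ball. *)
  destruct (completeness (fun t => exists y, ~ K y /\ t = - e y)) as [l [Hub Hlub]].
  { exists 0; intros t [y [_ ->]]; pose proof (dot_self_nonneg d (vsub y p)); unfold e; lra. }
  { now exists (- e y0), y0. }
  set (m := - l).
  assert (Hout : forall y, ~ K y -> m <= e y).
  { intros y Hy; assert (- e y <= l) by (apply Hub; now exists y); unfold m; lra. }
  assert (Hopen : forall y, e y < m -> K y).
  { intros y Hy; apply NNPP; intros Hn; specialize (Hout y Hn); lra. }
  assert (Hm : r * r <= m).
  { assert (l <= - (r * r)); [|unfold m; lra].
    apply Hlub; intros t [y [Hy ->]].
    assert (r * r < e y); [|lra]; apply Rnot_le_lt; intros H; now apply Hy, Hball. }
  assert (Hmpos : 0 < m) by nra.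
  destruct (coord_bound d p) as [Mp [HMp Hp]].
  (* The infimum need not be attained outside [K], so [b] is obtained as a cluster point of nearly
     closest outside points. *)
  destruct (nested_cluster d (fun k y => ~ K y /\ e y <= m + / INR (S k)) (Mp + (m + 2)))
    as [b Hb].
  { intros k; apply NNPP; intros Hn.
    assert (l <= l - / INR (S k)); [|pose proof (inv_INR_S_pos k); lra].
    apply Hlub; intros t [y [Hy ->]].
    assert (~ e y <= m + / INR (S k)) by (intros H; apply Hn; now exists y).
    unfold m in *; lra. }
  { intros k y [H1 H2]; split; [exact H1|].
    pose proof (inv_INR_mono k (S k) ltac:(lia)); lra. }
  { intros k y [_ H] i; pose proof (coord_sqr_le_dot d (vsub y p) i) as H1.
    assert (H2 : / INR (S k) <= 1) by (rewrite <- Rinv_1; apply (inv_INR_mono 0 k); lia).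
    fold (e y) in H1.
    assert (Rabs (vsub y p i) <= m + 2) by (apply abs_le_of_sqr_le; nra).
    replace (y i) with (p i + vsub y p i) by (unfold vsub; ring).
    eapply Rle_trans; [apply Rabs_triang|]; specialize (Hp i); lra. }
  assert (Heb : e b = m).
  { destruct (Rtotal_order (e b) m) as [H|[H|H]]; [exfalso|exact H|exfalso].
    - destruct (dot_self_continuous (vsub b p) (m - e b) ltac:(lra)) as [del [Hdel Hc]].
      destruct (Hb 0%nat del Hdel) as [y [[Hy _] Hyb]].
      apply Hy, Hopen.
      assert (H1 : Rabs (e y - e b) < m - e b).
      { apply Hc; intro i; unfold vsub.
        replace (y i - p i - (b i - p i)) with (y i - b i) by ring; apply Hyb. }
      apply Rabs_def2 in H1; lra.
    - destruct (dot_self_continuous (vsub b p) ((e b - m) / 2) ltac:(lra)) as [del [Hdel Hc]].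
      destruct (inv_INR_lt ((e b - m) / 2) ltac:(lra)) as [k Hk].
      destruct (Hb k del Hdel) as [y [[_ Hy] Hyb]].
      assert (H1 : Rabs (e y - e b) < (e b - m) / 2).
      { apply Hc; intro i; unfold vsub.
        replace (y i - p i - (b i - p i)) with (y i - b i) by ring; apply Hyb. }
      apply Rabs_def2 in H1; lra. }
  exists b, (sqrt m); rewrite sqrt_sqrt by lra.
  split; [now apply sqrt_lt_R0|split; [exact Heb|split; [now apply Hout|split]]].
  - now apply closed_ball_of_open.
  - intros z Hz; apply Rnot_lt_le; intros Hc.
    set (c := dot d (vsub b p) (vsub z b)) in *.
    set (q := dot d (vsub z b) (vsub z b)).
    assert (Hq : 0 <= q) by apply dot_self_nonneg.
    (* Reflecting [z] slightly through [b] gives [b - s (z - b)]; this [s] makes its squared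
       distance [m - 2 s c + s s q] from [p] less than [m]. *)
    set (s := c / (q + 1)).
    assert (Hs : 0 < s) by (apply Rdiv_lt_0_compat; lra).
    assert (Hsq : s * (q + 1) = c) by (unfold s; field; lra).
    set (w := vsub (vsub b (vscal s (vsub z b))) p).
    assert (Hw : dot d w w < m).
    { replace w with (vadd (vsub b p) (vscal (- s) (vsub z b))) by (unfold w; vext; ring).
      rewrite dot_self_comb.
      fold c q; change (dot d (vsub b p) (vsub b p)) with (e b); rewrite Heb; nra. }
    destruct (dot_self_continuous w (m - dot d w w) ltac:(lra)) as [del [Hdel Hcont]].
    destruct (Hb 0%nat (del / (1 + s)) ltac:(apply Rdiv_lt_0_compat; lra))
      as [y [[Hy _] Hyb]].
    apply Hy.
    (* For an outside point [y] near [b], the point [y'] is still in the open ball, so [y] lies on a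
       segment between the points [y'] and [z] of [K]. *)
    set (y' := vsub (vscal (1 + s) y) (vscal s z)).
    assert (Hy' : K y').
    { apply Hopen; assert (H1 : Rabs (e y' - dot d w w) < m - dot d w w).
      { apply Hcont; intro i; unfold y', w, vsub, vscal.
        replace ((1 + s) * y i - s * z i - p i - (b i - s * (z i - b i) - p i))
          with ((1 + s) * (y i - b i)) by ring.
        rewrite Rabs_mult, (Rabs_pos_eq (1 + s)) by lra.
        replace del with ((1 + s) * (del / (1 + s))) by (field; lra).
        apply Rmult_lt_compat_l; [lra|apply Hyb]. }
      apply Rabs_def2 in H1; lra. }
    replace y with (fun i => (1 - s / (1 + s)) * y' i + s / (1 + s) * z i).
    + apply Hcv; [exact Hy'|exact Hz|]; split.
      * apply Rlt_le, Rdiv_lt_0_compat; lra.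
      * apply Rmult_le_reg_r with (1 + s); [lra|].
        unfold Rdiv; rewrite Rmult_assoc, Rinv_l by lra; lra.
    + unfold y'; vext; field; lra.
Qed.

(* The last condition says that [K] contains the ball of radius [rho] centred at
   [b + rho n], which touches the boundary at [b]. *)
Definition inner_ball_normal {d} (K : point d -> Prop) (n : point d) : Prop :=
  exists b rho, 0 < rho /\ dot d n n = 1 /\ (forall z, K z -> dot d n b <= dot d n z) /\
    forall y, dot d (vsub y b) (vsub y b) <= 2 * rho * dot d n (vsub y b) -> K y.

(** The point [b + t w] lies in the touching ball as soon as [t |w|^2 <= 2 rho n.w]. With
    [|w|^2 <= d B^2] and [n.w >= delta] one small [t0] serves all [w]. *)
Lemma inner_ball_locally_halfspace {d} (K : point d -> Prop) n :
  inner_ball_normal K n -> locally_halfspace K n.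
Proof.
  intros [b [rho [Hrho [Hn [Hsup Hball]]]]].
  apply (locally_halfspace_at K n b Hn Hsup); intros delta B Hdelta HB.
  pose proof (pos_INR d) as Hd.
  assert (HdB : 0 <= INR d * B * B) by (rewrite Rmult_assoc; apply Rmult_le_pos; nra).
  set (t0 := 2 * rho * delta / (INR d * B * B + 1)).
  assert (Ht0 : t0 * (INR d * B * B + 1) = 2 * rho * delta) by (unfold t0; field; lra).
  exists t0; split; [apply Rdiv_lt_0_compat; nra|].
  intros t w Ht Hnw HwB; apply Hball.
  replace (vsub (vadd b (vscal t w)) b) with (vscal t w) by (vext; ring).
  rewrite dot_vscal_l, !dot_vscal_r.
  pose proof (dot_self_bound d w B HwB HB) as Hw; pose proof (dot_self_nonneg d w).
  replace (2 * rho * (t * dot d n w)) with (t * (2 * rho * dot d n w)) by ring.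
  apply Rmult_le_compat_l; [lra|].
  assert (2 * rho * delta <= 2 * rho * dot d n w) by nra; nra.
Qed.

(* Move from an interior point in the direction [- v] until the boundary is almost
   reached: there the inscribed ball is small and touches from the far side. *)
Lemma inner_ball_normals_positive {d} (K : point d -> Prop) : convex_body K ->
  exists c, 0 < c /\ forall v : point d,
    (forall i, Rabs (v i) <= 1) -> (exists i, / 2 <= Rabs (v i)) ->
    exists n, inner_ball_normal K n /\ c <= dot d n v.
Proof.
  intros [Hcv [Hcl [[M HM] [p0 [r1 [Hr1 Hint]]]]]].
  set (r := r1 / 2).
  assert (Hr : 0 < r) by (unfold r; lra).
  assert (Hball : forall y, dot d (vsub y p0) (vsub y p0) <= r * r -> K y).
  { intros y Hy; apply Hint; intro i.
    pose proof (coord_sqr_le_dot d (vsub y p0) i).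
    change (y i - p0 i) with (vsub y p0 i).
    assert (Rabs (vsub y p0 i) <= r) by (apply abs_le_of_sqr_le; lra).
    unfold r in *; lra. }
  assert (Hp0 : K p0).
  { apply Hint; intro i; rewrite Rminus_diag, Rabs_R0; exact Hr1. }
  (* The final estimate is [s n.v >= r / 2], and the ray parameter [s] is at most [4 (|M| + 1)]. *)
  exists (r / (8 * (Rabs M + 1))); split.
  { pose proof (Rabs_pos M); apply Rdiv_lt_0_compat; lra. }
  intros v Hv1 [i0 Hv2].
  pose proof (pos_INR d) as Hd.
  assert (Hvv : dot d v v <= INR d) by (pose proof (dot_self_bound d v 1 Hv1); lra).
  pose proof (dot_self_nonneg d v) as Hvv0.
  set (ray := fun s => vsub p0 (vscal s v)).
  assert (HT : forall s, K (ray s) -> s <= 4 * (Rabs M + 1)).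
  { intros s Hs; apply Rnot_lt_le; intros Hlt.
    pose proof (HM _ Hs i0) as H1; pose proof (HM _ Hp0 i0) as H2.
    unfold ray, vsub, vscal in H1; pose proof (Rle_abs M); pose proof (Rabs_pos M).
    assert (H3 : Rabs (s * v i0) <= 2 * M).
    { replace (s * v i0) with (p0 i0 + - (p0 i0 - s * v i0)) by ring.
      eapply Rle_trans; [apply Rabs_triang|]; rewrite Rabs_Ropp; lra. }
    rewrite Rabs_mult, (Rabs_pos_eq s) in H3 by lra; nra. }
  set (s0 := r / (INR d + 1)).
  assert (Hs0 : s0 * (INR d + 1) = r) by (unfold s0; field; lra).
  assert (Hs0pos : 0 < s0) by (apply Rdiv_lt_0_compat; lra).
  assert (HsT : K (ray s0)).
  { apply Hball; unfold ray.
    replace (vsub (vsub p0 (vscal s0 v)) p0) with (vscal (- s0) v) by (vext; ring).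
    rewrite dot_vscal_l, dot_vscal_r.
    assert (s0 * s0 * dot d v v <= s0 * s0 * INR d) by nra; nra. }
  destruct (completeness (fun s => K (ray s))) as [t [Hub Hlub]].
  { exists (4 * (Rabs M + 1)); exact HT. }
  { now exists s0. }
  assert (Ht0 : s0 <= t) by now apply Hub.
  (* The outside point [ray (t + eta)] is at distance [2 eta |v|] from the centre [ray s]; by the
     choice of [s0] this is at most [r / 2], which bounds [rho]. *)
  set (eta := s0 / 4); set (s := t - eta).
  assert (Hs : exists s', K (ray s') /\ s < s').
  { apply NNPP; intros Hn; assert (t <= s); [|unfold s, eta in *; lra].
    apply Hlub; intros s' Hs'; apply Rnot_lt_le; intros Hlt; apply Hn; now exists s'. }
  destruct Hs as [s' [Hs' Hss']].
  assert (Hspos : 0 < s) by (unfold s, eta; lra).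
  (* The homothety centred at [ray s'] with ratio [1 - th] carries the ball around [p0] to a ball
     around [ray s] inside [K]. *)
  set (th := s / s').
  assert (Hth : 0 < th < 1).
  { unfold th; split; [apply Rdiv_lt_0_compat; lra|].
    apply Rmult_lt_reg_r with s'; [lra|]; unfold Rdiv.
    rewrite Rmult_assoc, Rinv_l by lra; lra. }
  assert (Hths : th * s' = s) by (unfold th; field; lra).
  destruct (inscribed_ball_touches K (ray s) ((1 - th) * r) (ray (t + eta)) Hcv Hcl)
    as [b [rho [Hrho [Hb [Hle [Hin Hsup]]]]]].
  { apply Rmult_lt_0_compat; lra. }
  { intros y Hy.
    set (y' := vadd p0 (vscal (/ (1 - th)) (vsub y (ray s)))).
    replace y with (fun i => (1 - th) * y' i + th * ray s' i).
    - apply Hcv; [|exact Hs'|lra]; apply Hball.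
      replace (vsub y' p0) with (vscal (/ (1 - th)) (vsub y (ray s)))
        by (unfold y'; vext; ring).
      rewrite dot_vscal_l, dot_vscal_r.
      replace (r * r) with (/ (1 - th) * (/ (1 - th) * ((1 - th) * r * ((1 - th) * r))))
        by (field; lra).
      assert (0 < / (1 - th)) by (apply Rinv_0_lt_compat; lra).
      do 2 (apply Rmult_le_compat_l; [lra|]); exact Hy.
    - unfold y', ray; vext; rewrite <- Hths; field; lra. }
  { intros H; apply Hub in H; unfold eta in H; lra. }
  assert (Hrho2 : rho <= r / 2).
  { replace (vsub (ray (t + eta)) (ray s)) with (vscal (- (2 * eta)) v) in Hle
      by (unfold ray, s; vext; ring).
    rewrite dot_vscal_l, dot_vscal_r in Hle.
    assert (Heta : 4 * eta * (INR d + 1) = r) by (unfold eta; lra).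
    assert (eta * eta * dot d v v <= eta * eta * INR d) by nra.
    assert (4 * (eta * eta * INR d) <= r / 2 * (r / 2)) by (rewrite <- Heta; nra).
    apply Rnot_lt_le; intros Hlt; nra. }
  set (n := vscal (- / rho) (vsub b (ray s))).
  assert (Hirho : 0 < / rho) by now apply Rinv_0_lt_compat.
  assert (Hnn : dot d n n = 1).
  { unfold n; rewrite dot_vscal_l, dot_vscal_r, Hb; field; lra. }
  assert (Hbn : vsub b (ray s) = vscal (- rho) n) by (unfold n; vext; field; lra).
  exists n; split.
  - exists b, rho; split; [exact Hrho|split; [exact Hnn|split]].
    + intros z Hz; specialize (Hsup z Hz); rewrite Hbn in Hsup.
      rewrite dot_vscal_l, dot_vsub_r in Hsup; nra.
    + intros y Hy; apply Hin.
      replace (vsub y (ray s)) with (vadd (vsub y b) (vscal (- rho) n))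
        by (rewrite <- Hbn; vext; ring).
      rewrite dot_self_comb, Hnn, (dot_comm d (vsub y b) n); lra.
  (* The supporting inequality is tested at the point of the ball around [p0] that is lowest in
     direction [n]; it yields [s n.v >= r - rho]. *)
  - assert (Hz : K (vsub p0 (vscal r n))).
    { apply Hball.
      replace (vsub (vsub p0 (vscal r n)) p0) with (vscal (- r) n) by (vext; ring).
      rewrite dot_vscal_l, dot_vscal_r, Hnn; lra. }
    specialize (Hsup _ Hz).
    replace (vsub (vsub p0 (vscal r n)) b) with (vadd (vscal s v) (vscal (rho - r) n)) in Hsup.
    2:{ replace b with (vadd (ray s) (vscal (- rho) n)) by (rewrite <- Hbn; vext; ring).
        unfold ray; vext; ring. }
    rewrite Hbn, dot_vscal_l, dot_vadd_r, !dot_vscal_r, Hnn in Hsup.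
    assert (Hsn : r / 2 <= s * dot d n v) by nra.
    assert (Hs4 : s <= 4 * (Rabs M + 1)).
    { assert (t <= 4 * (Rabs M + 1)) by (apply Hlub; exact HT); unfold s, eta; lra. }
    pose proof (Rabs_pos M).
    assert (Hnv : 0 <= dot d n v) by nra.
    apply Rmult_le_reg_r with (8 * (Rabs M + 1)); [lra|].
    unfold Rdiv; rewrite Rmult_assoc, Rinv_l by lra; nra.
Qed.

(** * A finite positively spanning set of inner normals *)

Lemma interval_net delta : 0 < delta ->
  exists l, forall t, Rabs t <= 1 -> exists v, In v l /\ Rabs v <= 1 /\ Rabs (v - t) <= delta.
Proof.
  intros Hdel.
  assert (H : forall k, exists l, forall t, Rabs t <= 1 -> t <= -1 + INR k * delta ->
            exists v, In v l /\ Rabs v <= 1 /\ Rabs (v - t) <= delta).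
  { induction k as [|k [l IH]].
    - exists [-1]; intros t Ht Htk; simpl in Htk; exists (-1); split; [now left|].
      assert (- 1 <= t) by (pose proof (Rle_abs (- t)); rewrite Rabs_Ropp in *; lra).
      split; apply Rabs_le; lra.
    - exists (-1 + INR k * delta :: l); intros t Ht Htk; rewrite S_INR in Htk.
      destruct (Rle_dec t (-1 + INR k * delta)) as [Hc|Hc].
      + destruct (IH t Ht Hc) as [v [Hv Hv']]; exists v; split; [now right|exact Hv'].
      + exists (-1 + INR k * delta); split; [now left|].
        pose proof (Rle_abs t); pose proof (pos_INR k).
        assert (0 <= INR k * delta) by nra.
        split; apply Rabs_le; lra. }
  destruct (INR_unbounded (2 / delta)) as [k Hk].
  destruct (H k) as [l Hl]; exists l; intros t Ht; apply Hl; [exact Ht|].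
  assert (2 < INR k * delta).
  { replace 2 with (2 / delta * delta) by (field; lra); now apply Rmult_lt_compat_r. }
  pose proof (Rle_abs t); lra.
Qed.

(** Each vector of a finite net of the sup-norm sphere gets a normal [u] with [u.v >= c]. A nonzero
    [x] with all [u.x <= 0] could be scaled to sup norm 1 and rounded to a net vector [g], where
    [u.g] would be less than [c]. *)
Lemma exists_pos_spanning_normals {d} (K : point d -> Prop) : convex_body K ->
  exists U, (forall u, In u U -> inner_ball_normal K u) /\ pos_spanning U.
Proof.
  intros HK; destruct (inner_ball_normals_positive K HK) as [c [Hc Hnorm]].
  pose proof (pos_INR d) as Hd.
  (* The first bound keeps a coordinate of size at least [/ 2] after rounding; the second keeps the
     error [d del] of [u] at most [c / 2]. *)
  set (del := Rmin (/ 2) (c / (2 * (INR d + 1)))).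
  assert (Hdel : 0 < del).
  { apply Rmin_pos; [lra|apply Rdiv_lt_0_compat; lra]. }
  assert (Hdelc : del * (INR d + 1) <= c / 2).
  { replace (c / 2) with (c / (2 * (INR d + 1)) * (INR d + 1)) by (field; lra).
    apply Rmult_le_compat_r; [lra|apply Rmin_r]. }
  destruct (interval_net del Hdel) as [vals Hvals].
  assert (HU : forall G : list (point d), exists U,
            (forall u, In u U -> inner_ball_normal K u) /\
            forall v, In v G -> (forall i, Rabs (v i) <= 1) -> (exists i, / 2 <= Rabs (v i)) ->
              exists u, In u U /\ c <= dot d u v).
  { induction G as [|v G [U [HU1 HU2]]]; [exists []; split; [intros ? []|intros ? []]|].
    destruct (classic ((forall i, Rabs (v i) <= 1) /\ exists i, / 2 <= Rabs (v i)))
      as [[H1 H2]|Hn].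
    - destruct (Hnorm v H1 H2) as [n [Hn1 Hn2]]; exists (n :: U); split.
      + intros u [<-|Hu]; auto.
      + intros w [<-|Hw] H3 H4; [exists n; split; [now left|exact Hn2]|].
        destruct (HU2 w Hw H3 H4) as [u [Hu Hu']]; exists u; split; [now right|exact Hu'].
    - exists U; split; [exact HU1|]; intros w [<-|Hw] H3 H4; [now contradiction Hn|auto]. }
  destruct (HU (all_funs d vals)) as [U [HU1 HU2]]; exists U; split; [exact HU1|].
  intros x Hx; apply NNPP; intros Hx0.
  destruct (max_coord d x Hx0) as [i0 [Hi0 Hmax]].
  set (v := vscal (/ Rabs (x i0)) x).
  assert (Hinv : 0 < / Rabs (x i0)) by now apply Rinv_0_lt_compat.
  assert (Hv : forall j, Rabs (v j) = / Rabs (x i0) * Rabs (x j)).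
  { intro j; unfold v, vscal; rewrite Rabs_mult, (Rabs_pos_eq (/ _)) by lra; reflexivity. }
  assert (Hv1 : forall j, Rabs (v j) <= 1).
  { intro j; rewrite Hv; rewrite <- (Rinv_l (Rabs (x i0))) by lra.
    apply Rmult_le_compat_l; [lra|apply Hmax]. }
  assert (Hvi : Rabs (v i0) = 1) by (rewrite Hv; apply Rinv_l; lra).
  set (g := fun j => proj1_sig (constructive_indefinite_description _ (Hvals (v j) (Hv1 j)))).
  assert (Hg : forall j, In (g j) vals /\ Rabs (g j) <= 1 /\ Rabs (g j - v j) <= del).
  { intro j; exact (proj2_sig (constructive_indefinite_description _
                                 (Hvals (v j) (Hv1 j)))). }
  destruct (HU2 g) as [u [Hu Huc]].
  { apply in_all_funs; intro; apply Hg. }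
  { intro; apply Hg. }
  { exists i0; destruct (Hg i0) as [_ [_ H]].
    assert (del <= / 2) by apply Rmin_l.
    assert (Rabs (v i0) <= Rabs (g i0) + Rabs (g i0 - v i0)); [|lra].
    replace (v i0) with (g i0 + - (g i0 - v i0)) at 1 by ring.
    eapply Rle_trans; [apply Rabs_triang|]; rewrite Rabs_Ropp; lra. }
  assert (Huv : dot d u v <= 0).
  { unfold v; rewrite dot_vscal_r; specialize (Hx u Hu); nra. }
  assert (Hun : norm1 u <= INR d * 1).
  { apply norm1_bound; intro i; apply abs_le_of_sqr_le; [lra|].
    destruct (HU1 u Hu) as [b [rho [_ [E _]]]].
    pose proof (coord_sqr_le_dot d u i); lra. }
  assert (Hgv : Rabs (dot d u (vsub g v)) <= norm1 u * del)
    by (apply dot_bound; intro; apply Hg).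
  rewrite dot_vsub_r in Hgv.
  pose proof (Rle_abs (dot d u g - dot d u v)); nra.
Qed.

Lemma covering_4d {d} (K : point d -> Prop) lam : (1 <= d)%nat -> convex_body K ->
  (forall n, 0 < lam n) -> (forall M : R, exists n, M < lam n) ->
  translative_covering_mult K lam (4 * d).
Proof.
  intros hd HK Hpos Hunb.
  destruct (exists_pos_spanning_normals K HK) as [U0 [HU1 HU2]].
  destruct (pos_spanning_reduce U0 HU2) as [U [HUi [HUl HUp]]].
  replace (4 * d)%nat with (2 * (2 * d))%nat by lia.
  apply (covering_from_halfspaces K lam U); auto; [lia| |].
  - intros u Hu; apply inner_ball_locally_halfspace; auto.
  - intros a p _; eapply Nat.le_trans; [apply filter_length_le|exact HUl].
Qed.

(** * Smooth boundary points *)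

Lemma attains_min {d} (K : point d -> Prop) (f : point d -> R) B :
  Defs.closed_set K -> bounded_set K -> (exists y, K y) -> (forall y, K y -> B <= f y) ->
  (forall x eps, 0 < eps -> exists delta, 0 < delta /\
     forall y, (forall i, Rabs (y i - x i) < delta) -> Rabs (f y - f x) < eps) ->
  exists c, K c /\ forall y, K y -> f c <= f y.
Proof.
  intros Hcl [M HM] [y0 Hy0] HB Hf.
  destruct (completeness (fun t => exists y, K y /\ t = - f y)) as [l [Hub Hlub]].
  { exists (- B); intros t [y [Hy ->]]; specialize (HB y Hy); lra. }
  { now exists (- f y0), y0. }
  destruct (nested_cluster d (fun k y => K y /\ f y <= - l + / INR (S k)) M) as [c Hc].
  { intros k; apply NNPP; intros Hn.
    assert (l <= l - / INR (S k)); [|pose proof (inv_INR_S_pos k); lra].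
    apply Hlub; intros t [y [Hy ->]].
    assert (~ f y <= - l + / INR (S k)) by (intros H; apply Hn; now exists y); lra. }
  { intros k y [H1 H2]; split; [exact H1|].
    pose proof (inv_INR_mono k (S k) ltac:(lia)); lra. }
  { intros k y [H _]; now apply HM. }
  exists c; split.
  - apply Hcl; intros eps He; destruct (Hc 0%nat eps He) as [y [[Hy _] Hyc]].
    exists y; split; [exact Hy|]; intro i; rewrite Rabs_minus_sym; apply Hyc.
  - intros y Hy; apply Rle_trans with (- l).
    + apply Rnot_lt_le; intros Hlt.
      destruct (Hf c ((f c + l) / 2) ltac:(lra)) as [del [Hdel Hcont]].
      destruct (inv_INR_lt ((f c + l) / 2) ltac:(lra)) as [k Hk].
      destruct (Hc k del Hdel) as [x [[_ Hx] Hxc]].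
      specialize (Hcont x Hxc); apply Rabs_def2 in Hcont; lra.
    + assert (- f y <= l) by (apply Hub; now exists y); lra.
Qed.

(** At the nearest point [c] to [q], a [y] in [K] making an acute angle with [q - c] would allow a
    short step from [c] towards [y] that comes closer to [q]. *)
Lemma closest_point {d} (K : point d -> Prop) q :
  convex K -> Defs.closed_set K -> bounded_set K -> (exists y, K y) ->
  exists c, K c /\ forall y, K y -> dot d (vsub q c) (vsub y c) <= 0.
Proof.
  intros Hcv Hcl Hbd Hne.
  destruct (attains_min K (fun y => dot d (vsub y q) (vsub y q)) 0 Hcl Hbd Hne)
    as [c [Hc Hmin]].
  { intros; apply dot_self_nonneg. }
  { intros x eps He.
    destruct (dot_self_continuous (vsub x q) eps He) as [del [Hdel Hcont]].
    exists del; split; [exact Hdel|]; intros y Hy; apply Hcont; intro i; unfold vsub.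
    replace (y i - q i - (x i - q i)) with (y i - x i) by ring; apply Hy. }
  exists c; split; [exact Hc|]; intros y Hy; apply Rnot_lt_le; intros Hlt.
  set (al := dot d (vsub q c) (vsub y c)) in *.
  set (be := dot d (vsub y c) (vsub y c)).
  assert (Hbe : 0 <= be) by apply dot_self_nonneg.
  set (t := Rmin 1 (al / (be + 1))).
  assert (Ht : 0 < t <= 1).
  { split; [apply Rmin_pos; [lra|apply Rdiv_lt_0_compat; lra]|apply Rmin_l]. }
  assert (Htb : t * (be + 1) <= al).
  { replace al with (al / (be + 1) * (be + 1)) by (field; lra).
    apply Rmult_le_compat_r; [lra|apply Rmin_r]. }
  assert (H : dot d (vsub c q) (vsub c q) <=
              dot d (vadd (vsub c q) (vscal t (vsub y c)))
                    (vadd (vsub c q) (vscal t (vsub y c)))).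
  { replace (vadd (vsub c q) (vscal t (vsub y c)))
      with (vsub (fun i => (1 - t) * c i + t * y i) q) by (vext; ring).
    apply Hmin, Hcv; [exact Hc|exact Hy|lra]. }
  rewrite dot_self_comb in H; fold be in H.
  replace (vsub c q) with (vscal (-1) (vsub q c)) in H by (vext; ring).
  rewrite (dot_vscal_l d (-1) (vsub y c)) in H; fold al in H; nra.
Qed.

Lemma exists_support_point {d} (K : point d -> Prop) u :
  Defs.closed_set K -> bounded_set K -> (exists y, K y) ->
  exists b, K b /\ forall y, K y -> dot d u b <= dot d u y.
Proof.
  intros Hcl [M HM] Hne; pose proof (norm1_nonneg d u) as Hu.
  apply (attains_min K (dot d u) (- (norm1 u * M))); [exact Hcl|now exists M|exact Hne| |].
  - intros y Hy; pose proof (dot_bound d u y M (HM y Hy)).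
    pose proof (Rle_abs (- dot d u y)); rewrite Rabs_Ropp in *; lra.
  - intros x eps He; exists (eps / (norm1 u + 1)); split; [apply Rdiv_lt_0_compat; lra|].
    intros y Hy; rewrite <- dot_vsub_r.
    eapply Rle_lt_trans; [apply dot_bound with (M := eps / (norm1 u + 1))|].
    + intro i; apply Rlt_le, Hy.
    + apply Rmult_lt_reg_r with (norm1 u + 1); [lra|].
      replace (norm1 u * (eps / (norm1 u + 1)) * (norm1 u + 1)) with (norm1 u * eps)
        by (field; lra); lra.
Qed.

Lemma interior_strictly_inside {d} (K : point d -> Prop) z r u c :
  0 < r -> (forall y, (forall i, Rabs (y i - z i) < r) -> K y) -> u <> vzero ->
  (forall y, K y -> dot d u y <= c) -> dot d u z < c.
Proof.
  intros Hr Hball Hu Hc.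
  destruct (coord_bound d u) as [M [HM HuM]].
  set (e := r / (M + 1)).
  assert (He : 0 < e) by (apply Rdiv_lt_0_compat; lra).
  assert (HeM : e * (M + 1) = r) by (unfold e; field; lra).
  assert (Huu : 0 < dot d u u).
  { apply Rnot_le_lt; intros H; now apply Hu, dot_self_zero. }
  assert (H : dot d u (vadd z (vscal e u)) <= c).
  { apply Hc, Hball; intro i; unfold vadd, vscal.
    replace (z i + e * u i - z i) with (e * u i) by ring.
    rewrite Rabs_mult, (Rabs_pos_eq e) by lra; specialize (HuM i); nra. }
  rewrite dot_vadd_r, dot_vscal_r in H; nra.
Qed.

(* If the ray from [b] along [w] misses [K], the separating directions of its points
   accumulate at a second supporting hyperplane. *)
Lemma smooth_ray {d} (K : point d -> Prop) u b w :
  convex_body K -> smooth_at K b -> u <> vzero -> K b ->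
  (forall y, K y -> dot d u y <= dot d u b) -> dot d u w < 0 ->
  exists t, 0 < t /\ K (vadd b (vscal t w)).
Proof.
  intros [Hcv [Hcl [Hbd [z [r [Hr Hball]]]]]] Hsm Hu Hb Hsup Hw.
  apply NNPP; intros Hn.
  pose proof (norm1_nonneg d w) as HW.
  (* The directions [v] support [K] at [b] up to an error tending to 0 and satisfy [v.w >= 0]. They
     come from projecting [b + t w], with [t = / INR (S k)], onto [K]; a coordinate of absolute
     value 1 keeps the limit nonzero. *)
  destruct (nested_cluster d (fun k v =>
    (forall i, Rabs (v i) <= 1) /\ (exists i, Rabs (v i) = 1) /\
    (forall y, K y -> dot d v (vsub y b) <= / INR (S k) * norm1 w) /\ 0 <= dot d v w) 1)
    as [v Hv].
  { intros k; pose proof (inv_INR_S_pos k) as Ht; set (t := / INR (S k)) in *.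
    set (q := vadd b (vscal t w)).
    assert (Hq : ~ K q) by (intros H; apply Hn; now exists t).
    destruct (closest_point K q Hcv Hcl Hbd (ex_intro _ b Hb)) as [c [Hc Hcq]].
    assert (Hqc : vsub q c <> vzero).
    { intros E; apply Hq; replace q with c; [exact Hc|].
      apply functional_extensionality; intro i.
      apply (f_equal (fun x => x i)) in E; unfold vsub, vzero in E; lra. }
    destruct (max_coord d _ Hqc) as [i0 [Hi0 Hmax]].
    set (m := Rabs (vsub q c i0)) in *.
    assert (Him : 0 < / m) by now apply Rinv_0_lt_compat.
    set (v := vscal (/ m) (vsub q c)).
    assert (Hvi : forall i, Rabs (v i) = / m * Rabs (vsub q c i)).
    { intro i; unfold v, vscal at 1; now rewrite Rabs_mult, (Rabs_pos_eq (/ m)) by lra. }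
    assert (Hv1 : forall i, Rabs (v i) <= 1).
    { intro i; rewrite Hvi, <- (Rinv_l m) by lra; apply Rmult_le_compat_l; [lra|apply Hmax]. }
    assert (Hvc : forall y, K y -> dot d v (vsub y c) <= 0).
    { intros y Hy; unfold v; rewrite dot_vscal_l; specialize (Hcq y Hy); nra. }
    assert (Hvq : 0 <= dot d v (vsub q c)).
    { unfold v; rewrite dot_vscal_l; pose proof (dot_self_nonneg d (vsub q c)); nra. }
    assert (Hvw : dot d v w <= norm1 w).
    { rewrite dot_comm; pose proof (dot_bound d w v 1 Hv1); pose proof (Rle_abs (dot d w v)).
      lra. }
    assert (Eq : dot d v q = dot d v b + t * dot d v w).
    { unfold q; now rewrite dot_vadd_r, dot_vscal_r. }
    pose proof (Hvc b Hb) as Hvb; rewrite dot_vsub_r in Hvb, Hvq.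
    exists v; split; [exact Hv1|split; [|split]].
    - exists i0; rewrite Hvi; apply Rinv_l; unfold m in *; lra.
    - intros y Hy; specialize (Hvc y Hy); rewrite dot_vsub_r in *; nra.
    - nra. }
  { intros k v [H1 [H2 [H3 H4]]]; repeat split; auto.
    intros y Hy; specialize (H3 y Hy).
    pose proof (inv_INR_mono k (S k) ltac:(lia)); nra. }
  { intros k v [H _]; exact H. }
  assert (Happ : forall h eps k, 0 < eps -> exists x, Rabs (dot d h x - dot d h v) < eps /\
    (exists i, Rabs (x i) = 1) /\ (forall i, Rabs (x i - v i) < eps) /\
    (forall y, K y -> dot d x (vsub y b) <= / INR (S k) * norm1 w) /\ 0 <= dot d x w).
  { intros h eps k He; pose proof (norm1_nonneg d h) as Hh.
    set (e := eps / (norm1 h + 1)).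
    assert (He' : 0 < e) by (apply Rdiv_lt_0_compat; lra).
    assert (Heh : e * (norm1 h + 1) = eps) by (unfold e; field; lra).
    destruct (Hv k e He') as [x [[_ [H2 [H3 H4]]] H5]]; exists x.
    split; [|split; [exact H2|split; [|split; [exact H3|exact H4]]]].
    - rewrite <- dot_vsub_r.
      eapply Rle_lt_trans; [apply dot_bound with (M := e); intro; apply Rlt_le, H5|]; nra.
    - intro i; eapply Rlt_le_trans; [apply H5|nra]. }
  assert (Hv0 : v <> vzero).
  { intros E; destruct (Happ vzero (/ 2) 0%nat ltac:(lra)) as [x [_ [[i Hi] [Hx _]]]].
    specialize (Hx i); rewrite E in Hx; unfold vzero in Hx; rewrite Rminus_0_r, Hi in Hx; lra. }
  assert (Hvsup : forall y, K y -> dot d v y <= dot d v b).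
  { intros y Hy; apply Rminus_le; rewrite <- dot_vsub_r; apply Rnot_lt_le; intros Hlt.
    set (g := dot d v (vsub y b)) in *.
    destruct (inv_INR_lt (g / (2 * (norm1 w + 1)))) as [k Hk].
    { apply Rdiv_lt_0_compat; lra. }
    destruct (Happ (vsub y b) (g / 2) k ltac:(lra)) as [x [H1 [_ [_ [H2 _]]]]].
    specialize (H2 y Hy); rewrite !(dot_comm d (vsub y b)) in H1; fold g in H1.
    apply Rabs_def2 in H1.
    assert (/ INR (S k) * (norm1 w + 1) < g / 2).
    { replace (g / 2) with (g / (2 * (norm1 w + 1)) * (norm1 w + 1)) by (field; lra).
      apply Rmult_lt_compat_r; lra. }
    pose proof (inv_INR_S_pos k); nra. }
  assert (Hvw : 0 <= dot d v w).
  { apply Rnot_lt_le; intros Hlt.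
    destruct (Happ w (- dot d v w) 0%nat ltac:(lra)) as [x [H1 [_ [_ [_ H2]]]]].
    rewrite !(dot_comm d w) in H1; apply Rabs_def2 in H1; lra. }
  assert (Hsupp : forall x, x <> vzero -> (forall y, K y -> dot d x y <= dot d x b) ->
            supporting_hyperplane K (fun y => dot d x y = dot d x b) b).
  { intros x Hx0 Hx; split; [exact Hb|split; [reflexivity|]].
    exists x, (dot d x b); split; [exact Hx0|split; [reflexivity|exact Hx]]. }
  pose proof (Hsm _ _ (Hsupp u Hu Hsup) (Hsupp v Hv0 Hvsup)) as Heq.
  pose proof (interior_strictly_inside K z r u _ Hr Hball Hu Hsup) as Hzu.
  pose proof (interior_strictly_inside K z r v _ Hr Hball Hv0 Hvsup) as Hzv.
  (* With this [tau > 0] the point [b + w - tau (z - b)] lies on the first hyperplane, hence on the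
     second; then [v.w = tau v.(z - b)] is negative, a contradiction. *)
  set (tau := dot d u w / (dot d u z - dot d u b)).
  assert (Htau : tau * (dot d u z - dot d u b) = dot d u w) by (unfold tau; field; lra).
  assert (H : dot d v (vadd b (vsub w (vscal tau (vsub z b)))) = dot d v b).
  { apply Heq; dots; lra. }
  rewrite dot_vadd_r, dot_vsub_r, dot_vscal_r, dot_vsub_r in H.
  assert (Htaupos : 0 < tau) by nra; nra.
Qed.

(** Induction on the dimension through the slice at the first coordinate of [w]: each vertex of the
    slice is a convex combination of two vertices of the box. *)
Lemma box_in_convex d (A : point d -> Prop) (lo hi w : point d) : convex A ->
  (forall f : Fin.t d -> bool, A (fun i => if f i then hi i else lo i)) ->
  (forall i, exists t, 0 <= t <= 1 /\ w i = (1 - t) * lo i + t * hi i) -> A w.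
Proof.
  revert A lo hi w; induction d as [|n IH]; intros A lo hi w Hcv Hvert Hw.
  - replace w with (fun i : Fin.t 0 => if true then hi i else lo i); [apply (Hvert (fun _ => true))|].
    apply functional_extensionality; intro i; inversion i.
  - rewrite (vcons_eta w).
    apply (IH (fun y => A (vcons (w Fin.F1) y)) (fun i => lo (Fin.FS i))
              (fun i => hi (Fin.FS i))).
    + intros x y t Hx Hy Ht.
      replace (vcons (w Fin.F1) (fun i => (1 - t) * x i + t * y i))
        with (fun i => (1 - t) * vcons (w Fin.F1) x i + t * vcons (w Fin.F1) y i).
      * now apply Hcv.
      * apply functional_extensionality; apply fin_S_forall; [simpl; ring|reflexivity].
    + intros f; destruct (Hw Fin.F1) as [t [Ht ->]].
      assert (Hf : forall c, A (vcons (if c : bool then hi Fin.F1 else lo Fin.F1)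
                     (fun i => if f i then hi (Fin.FS i) else lo (Fin.FS i)))).
      { intros c; specialize (Hvert (fun i => Fin.caseS' i (fun _ => bool) c f)).
        match type of Hvert with
          A ?x => exact (eq_ind x A Hvert _ (vcons_eta x))
        end. }
      pose proof (Hcv _ _ t (Hf false) (Hf true) Ht) as H.
      match goal with |- A ?x => match type of H with A ?y => replace x with y end end;
        [exact H|].
      apply functional_extensionality; apply fin_S_forall; [reflexivity|intro i; simpl; ring].
    + intro i; apply Hw.
Qed.

Lemma shrink_ray {d} (K : point d -> Prop) b w t t' : convex K -> K b ->
  K (vadd b (vscal t w)) -> 0 < t' <= t -> K (vadd b (vscal t' w)).
Proof.
  intros Hcv Hb Ht Htt.
  replace (vadd b (vscal t' w))
    with (fun i => (1 - t' / t) * b i + t' / t * vadd b (vscal t w) i).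
  - apply Hcv; [exact Hb|exact Ht|]; split.
    + apply Rlt_le, Rdiv_lt_0_compat; lra.
    + apply Rmult_le_reg_r with t; [lra|].
      unfold Rdiv; rewrite Rmult_assoc, Rinv_l by lra; lra.
  - vext; field; lra.
Qed.

Lemma common_ray_length {d} (K : point d -> Prop) b (W : list (point d)) :
  convex K -> K b -> (forall w, In w W -> exists t, 0 < t /\ K (vadd b (vscal t w))) ->
  exists t0, 0 < t0 /\ forall t w, 0 < t <= t0 -> In w W -> K (vadd b (vscal t w)).
Proof.
  intros Hcv Hb; induction W as [|w W IH]; intros H.
  - exists 1; split; [lra|intros ? ? _ []].
  - destruct IH as [t1 [Ht1 H1]]; [intros; apply H; now right|].
    destruct (H w (or_introl eq_refl)) as [t2 [Ht2 H2]].
    exists (Rmin t1 t2); split; [now apply Rmin_pos|].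
    pose proof (Rmin_l t1 t2); pose proof (Rmin_r t1 t2).
    intros t v Ht [<-|Hv]; [apply (shrink_ray K b w t2)|apply H1]; auto; lra.
Qed.

(** Smoothness gives a segment in [K] only along one direction at a time. Uniformity comes from
    enclosing the directions with [n.w >= delta] and coordinates bounded by [B] in a box, possible
    since [n] is a coordinate direction; the finitely many vertices have a common segment length,
    and convexity handles the rest. *)
Lemma smooth_locally_halfspace {d} (K : point d -> Prop) j s : convex_body K ->
  smooth_at_coordinate_support_points K -> s * s = 1 ->
  locally_halfspace K (vscal s (ebas j)).
Proof.
  intros HK Hsm Hs; pose proof HK as [Hcv [Hcl [Hbd [z [r [Hr Hball]]]]]].
  set (n := vscal s (ebas j)).
  assert (Hne : exists y, K y).
  { exists z; apply Hball; intro i; rewrite Rminus_diag, Rabs_R0; exact Hr. }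
  destruct (exists_support_point K n Hcl Hbd Hne) as [b [Hb Hsup]].
  assert (Hdn : forall y, dot d n y = s * y j).
  { intro y; unfold n; rewrite dot_vscal_l, dot_comm, dot_ebas; reflexivity. }
  assert (Hej : ebas j j = 1).
  { unfold ebas; destruct (Fin.eq_dec j j); [reflexivity|congruence]. }
  assert (Hn0 : vscal (-1) n <> vzero).
  { intros E; apply (f_equal (fun x => x j)) in E; unfold n, vscal, vzero in E.
    rewrite Hej in E; nra. }
  assert (Hsup' : forall y, K y -> dot d (vscal (-1) n) y <= dot d (vscal (-1) n) b).
  { intros y Hy; rewrite !dot_vscal_l; specialize (Hsup y Hy); lra. }
  assert (Hsmb : smooth_at K b).
  { apply (Hsm j (b j)); split; [exact Hb|split; [reflexivity|]].
    exists (vscal (-1) n), (dot d (vscal (-1) n) b); split; [exact Hn0|split; [|exact Hsup']].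
    intro y; rewrite !dot_vscal_l, !Hdn; split; [intros ->; reflexivity|intros E].
    apply (Rmult_eq_reg_l s); [lra|nra]. }
  apply (locally_halfspace_at K n b); [|exact Hsup|].
  { rewrite Hdn; unfold n, vscal; rewrite Hej; lra. }
  intros delta B Hdelta HB.
  (* Larger than [B], so the box contains all relevant [w], and larger than [delta], so its side in
     direction [j] is not degenerate. *)
  set (C := B + delta + 1).
  set (lo := fun i => if Fin.eq_dec j i then s * delta else - C).
  set (hi := fun i => if Fin.eq_dec j i then s * C else C).
  set (vert := fun (f : Fin.t d -> bool) i => if f i then hi i else lo i).
  destruct (common_ray_length K b (map vert (all_funs d [true; false])) Hcv Hb)
    as [t0 [Ht0 Hray]].
  { intros w Hw; apply in_map_iff in Hw as [f [<- _]].
    apply (smooth_ray K (vscal (-1) n)); auto.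
    rewrite dot_vscal_l, Hdn; unfold vert, lo, hi.
    destruct (Fin.eq_dec j j); [|congruence]; destruct (f j); unfold C; nra. }
  exists t0; split; [exact Ht0|]; intros t w Ht Hnw HwB; rewrite Hdn in Hnw.
  apply (box_in_convex d (fun w => K (vadd b (vscal t w))) lo hi).
  - intros x y c Hx Hy Hc.
    replace (vadd b (vscal t (fun i => (1 - c) * x i + c * y i)))
      with (fun i => (1 - c) * vadd b (vscal t x) i + c * vadd b (vscal t y) i)
      by (vext; ring).
    now apply Hcv.
  - intros f; apply (Hray t (vert f) Ht), in_map, in_all_funs.
    intro i; destruct (f i); simpl; auto.
  - intro i; specialize (HwB i).
    pose proof (Rle_abs (w i)); pose proof (Rle_abs (- w i)); rewrite Rabs_Ropp in *.
    unfold lo, hi; destruct (Fin.eq_dec j i) as [<-|_].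
    + exists ((s * w j - delta) / (C - delta)).
      assert (HC : C - delta = B + 1) by (unfold C; ring).
      assert (s * w j <= B).
      { assert (s = 1 \/ s = -1) as [-> | ->]; [|lra|lra].
        destruct (Rmult_integral (s - 1) (s + 1)); [|left|right]; lra. }
      split; [split|].
      * apply Rmult_le_pos; [lra|apply Rlt_le, Rinv_0_lt_compat; lra].
      * apply Rmult_le_reg_r with (C - delta); [lra|].
        unfold Rdiv; rewrite Rmult_assoc, Rinv_l by lra; lra.
      * replace ((1 - (s * w j - delta) / (C - delta)) * (s * delta) +
                 (s * w j - delta) / (C - delta) * (s * C)) with (s * s * w j) by (field; lra).
        rewrite Hs; ring.
    + exists ((w i + C) / (2 * C)).
      assert (HC : B + 1 <= C) by (unfold C; lra).
      split; [split|].
      * apply Rmult_le_pos; [lra|apply Rlt_le, Rinv_0_lt_compat; lra].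
      * apply Rmult_le_reg_r with (2 * C); [lra|].
        unfold Rdiv; rewrite Rmult_assoc, Rinv_l by lra; lra.
      * field; lra.
Qed.

Lemma covering_2d_of_smooth {d} (K : point d -> Prop) lam : (1 <= d)%nat -> convex_body K ->
  (forall n, 0 < lam n) -> (forall M : R, exists n, M < lam n) ->
  smooth_at_coordinate_support_points K -> translative_covering_mult K lam (2 * d).
Proof.
  intros hd HK Hpos Hunb Hsm.
  set (U := flat_map (fun j => [vscal 1 (ebas j); vscal (-1) (ebas j)]) (fins d)).
  apply (covering_from_halfspaces K lam U); auto.
  - intros u Hu; apply in_flat_map in Hu as [j [_ [<-|[<-|[]]]]];
      apply smooth_locally_halfspace; auto; ring.
  - intros x Hx; vext.
    assert (H : forall s, In (vscal s (ebas i)) U -> s * x i <= 0).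
    { intros s Hs; specialize (Hx _ Hs); rewrite dot_vscal_l, dot_comm, dot_ebas in Hx.
      exact Hx. }
    assert (H1 : 1 * x i <= 0) by (apply H, in_flat_map; exists i; simpl; auto using in_fins).
    assert (H2 : -1 * x i <= 0) by (apply H, in_flat_map; exists i; simpl; auto using in_fins).
    lra.
  (* As [a] is positive, at most one of two opposite half-spaces contains [p], so each coordinate
     contributes at most one. *)
  - intros a p Ha; unfold U, halfspaces_at; apply Nat.le_trans with (length (fins d)); [|now rewrite length_fins].
    generalize (fins d); induction l as [|j l IH]; [simpl; lia|]; simpl.
    rewrite !dot_vscal_l.
    destruct (Rle_dec a (1 * dot d (ebas j) p)), (Rle_dec a (-1 * dot d (ebas j) p));
      simpl; try lia; lra.
Qed.

Theorem mainTheorem7 (d : nat) (hd : (1 <= d)%nat) (K : point d -> Prop)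
  (hK : convex_body K) (lam : nat -> R) (hpos : forall n, 0 < lam n)
  (hunb : forall M : R, exists n, M < lam n) :
  translative_covering_mult K lam (4 * d) /\
  (smooth_at_coordinate_support_points K ->
     translative_covering_mult K lam (2 * d)).
Proof.
  split; [now apply covering_4d|intros Hsm; now apply covering_2d_of_smooth].
Qed.
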